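(* Let $u,v\in S_n$, let $\mathbf{i}=(i_1,\ldots,i_m)$ be a double reduced word for $(u,v)$, and suppose an element $x\in G^{u,v}$ can be factored as $x=h\,x_{i_1}(t_1)\cdots x_{i_m}(t_m)$ with all $t_k$ nonzero elements of $\mathcal F$ and $h=\mathrm{diag}(h_1,\dots,h_n)\in H$. Then the factorization parameters are determined by $$h_i=\Delta^{u^{-1}(i)}_{u,e}(x)\qquad (i\in[1,n]),$$ and, for $k\in[1,m]$, with $y=\psi^{u,v}(x)$ and $i=|i_k|$, $$t_k=\begin{cases}\Delta^i_{v_{<k},u_{>k}}(y)^{-1}\,\Delta^i_{v_{<k},u_{\ge k}}(y)=\Delta^{i+1}_{v_{<k},u_{\ge k}}(y)^{-1}\,\Delta^{i+1}_{v_{<k},u_{>k}}(y) & \text{if } i_k<0,\\[2pt] \Delta^i_{v_{\le k},u_{>k}}(y)^{-1}\,\Delta^{i+1}_{v_{<k},u_{>k}}(y)=\Delta^i_{v_{<k},u_{>k}}(y)^{-1}\,\Delta^{i+1}_{v_{\le k},u_{>k}}(y) & \text{if } i_k>0.\end{cases}$$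
   Context: Let $\mathcal F$ be a skew field, $G=GL_n(\mathcal F)$, $[a,b]=\{a,a+1,\dots,b\}$ (empty if $a>b$), $e$ the identity permutation. Quasideterminants: for a square matrix $A=(a_{ij})_{i\in I,j\in J}$, $|A|_{ij}=a_{ij}$ if $|I|=1$; otherwise, if $A^{ij}$ ($A$ with row $i$ and column $j$ deleted) is invertible, $|A|_{ij}=a_{ij}-r_i(A^{ij})^{-1}c_j$, where $r_i$ is row $i$ of $A$ without $a_{ij}$ and $c_j$ is column $j$ of $A$ without $a_{ij}$. Positive quasiminors: for $I,J\subset[1,n]$ with $|I|=|J|$, $i\in I$, $j\in J$, $\Delta^{i,j}_{I,J}(x)=(-1)^{d_i(I)+d_j(J)}|x_{I,J}|_{i,j}$, where $x_{I,J}$ is the submatrix with rows $I$ and columns $J$, and $d_i(I)$ (resp. $d_j(J)$) is the number of elements of $I$ greater than $i$ (resp. of $J$ greater than $j$). For $u,v\in S_n$ and $k\in[1,n]$, $\Delta^k_{u,v}:=\Delta^{u(k),v(k)}_{u[1,k],v[1,k]}$. Groups: $B$ (resp. $B^-$) is the group of upper (resp. lower) triangular matrices in $G$, $H$ the diagonal matrices in $G$, $U$ the group of upper unitriangular matrices. Each $x\in B^-U$ is written uniquely as $x=[x]_-[x]_+$ with $[x]_-\in B^-$, $[x]_+\in U$. $S_n$ is embedded in $G$ as permutation matrices ($u e_k=e_{u(k)}$). Let $s_i=(i,i+1)$, let $\varphi_i:GL_2(\mathcal F)\to G$ be the embedding as the $2\times2$ block in rows and columns $i,i+1$, $\overline{s_i}=\varphi_i\begin{pmatrix}0&-1\\1&0\end{pmatrix}$,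 and for $w\in S_n$ let $\overline w=\overline{s_{j_1}}\cdots\overline{s_{j_l}}$ for any reduced word $w=s_{j_1}\cdots s_{j_l}$ (independent of the choice). The double Bruhat cell is $G^{u,v}=BuB\cap B^-vB^-$ and the reduced double Bruhat cell is $L^{u,v}=U\overline uU\cap B^-vB^-$; every element of $G^{u,v}$ is uniquely $hx'$ with $h\in H$, $x'\in L^{u,v}$. Positive inverse: $x^\iota=J_nx^{-1}J_n$, $J_n=\mathrm{diag}(-1,1,-1,\dots,(-1)^n)$. Twist: for $x'\in L^{u,v}$, $\psi^{u,v}(x')=([x'\,\overline{v^{-1}}]_-)^\iota\,(x'^\iota)^{-1}\,([\overline u^{\,-1}x']_+)^\iota$; it is extended to $G^{u,v}$ by $\psi^{u,v}(hx')=h\psi^{u,v}(x')$ for $h\in H$, $x'\in L^{u,v}$. One-parameter elements: for $i\in[1,n-1]$, $t\in\mathcal F^\times$, $x_i(t)=\varphi_i\begin{pmatrix}1&t\\0&1\end{pmatrix}$, $x_{-i}(t)=\varphi_i\begin{pmatrix}t^{-1}&0\\1&t\end{pmatrix}$. A double reduced word for $(u,v)$ is a sequence $(i_1,\dots,i_m)$ in $\{\pm1,\dots,\pm(n-1)\}$, $m=\ell(u)+\ell(v)$, which is a shuffle of $(-j_1,\dots,-j_{\ell(u)})$ with $(j_1,\dots,j_{\ell(u)})$ a reduced word for $u$, and a reduced word for $v$ in $[1,n-1]$. With the convention $s_{-i}=1$ for $i\in[1,n-1]$, set $u_{\ge k}=s_{-i_m}s_{-i_{m-1}}\cdots s_{-i_k}$,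 $u_{>k}=s_{-i_m}\cdots s_{-i_{k+1}}$, $v_{\le k}=s_{i_1}\cdots s_{i_k}$, $v_{<k}=s_{i_1}\cdots s_{i_{k-1}}$. *)

(* Defs.v *)
From HB Require Import structures.
From mathcomp Require Import all_boot all_order all_fingroup all_algebra.
From mathcomp Require Import boolp classical_sets.

Set Implicit Arguments.
Unset Strict Implicit.
Unset Printing Implicit Defensive.

Import GRing.Theory.
Local Open Scope ring_scope.

(* A skew field is an [F : unitRingType] together with [GRing.field_axiom F]
   (every nonzero element is a unit); commutativity of F is never assumed.
   The group is GL_n(F) with n = r + 1, so that n ranges over all positive
   integers. Indices are 0-based: the index k of [1, n] is the ordinal k - 1,
   and the index i of [1, n - 1] is the ordinal i - 1 of 'I_r. *)

Section Inverse.
Variables (F : unitRingType) (p q : nat).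
Implicit Type A : 'M[F]_(p, q).

(* [unitmx] and [invmx] require a commutative base ring. *)
Definition is_mxinv A (B : 'M[F]_(q, p)) : Prop :=
  A *m B = 1%:M /\ B *m A = 1%:M.

Definition mxinvertible A : Prop := exists B, is_mxinv A B.

Definition mxinv A : 'M[F]_(q, p) := xget 0 (is_mxinv A).

End Inverse.

Section Quasiminors.
Variables (F : unitRingType) (n : nat).
Implicit Types (x : 'M[F]_n) (I J : {set 'I_n}) (i j k : 'I_n) (u v : 'S_n).

Definition submx_of I J x : 'M[F]_(#|I|, #|J|) :=
  \matrix_(a, b) x (enum_val a) (enum_val b).

(* The quasideterminant |x_{I,J}|_{i,j}, meaningful under [quasidet_def]. *)
Definition quasidet I J i j x : F :=
  if #|I| == 1%N then x i j
  else x i j - ((\row_b x i (enum_val b))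
                *m mxinv (submx_of (I :\ i) (J :\ j) x)
                *m (\col_a x (enum_val a) j)) ord0 ord0.

Definition quasidet_def I J i j x : Prop :=
  [/\ i \in I, j \in J, #|I| = #|J| &
      #|I| = 1%N \/ mxinvertible (submx_of (I :\ i) (J :\ j) x)].

Definition above i I : nat := #|[set a in I | (i < a)%N]|.

Definition qminor I J i j x : F :=
  (-1) ^+ (above i I + above j J) * quasidet I J i j x.

Definition upto k : {set 'I_n} := [set l : 'I_n | (l <= k)%N].

(* Delta^k_{u,v}(x) *)
Definition Delta k u v x : F :=
  qminor (u @: upto k) (v @: upto k) (u k) (v k) x.

Definition Delta_def k u v x : Prop :=
  quasidet_def (u @: upto k) (v @: upto k) (u k) (v k) x.

End Quasiminors.

Section Words.
Variable r : nat.
Implicit Types (i : 'I_r) (u v : 'S_r.+1).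

(* The rows i and i + 1 attached to i in [1, n - 1]. *)
Definition lo i : 'I_r.+1 := widen_ord (leqnSn r) i.
Definition hi i : 'I_r.+1 := lift ord0 i.

Inductive letter := Pos of 'I_r | Neg of 'I_r.

Definition oppl (a : letter) : letter :=
  match a with Pos i => Neg i | Neg i => Pos i end.

(* s_i, with s_{-i} = 1 *)
Definition sgen (a : letter) : 'S_r.+1 :=
  match a with Pos i => tperm (lo i) (hi i) | Neg _ => 1%g end.

(* The product s_{a_1} s_{a_2} ... as a composition of functions, the last
   factor acting first; MathComp's [(s * t)%g] applies s first. *)
Definition sprod (w : seq letter) : 'S_r.+1 :=
  foldr (fun a p => (p * sgen a)%g) 1%g w.

Definition reduced_word u (w : seq 'I_r) : Prop :=
  sprod (map Pos w) = u /\
  forall w' : seq 'I_r, sprod (map Pos w') = u -> (size w <= size w')%N.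

Definition pos_part (w : seq letter) : seq 'I_r :=
  pmap (fun a => match a with Pos i => Some i | Neg _ => None end) w.
Definition neg_part (w : seq letter) : seq 'I_r :=
  pmap (fun a => match a with Pos _ => None | Neg i => Some i end) w.

(* The length of such a word is automatically l(u) + l(v). *)
Definition double_reduced_word u v (w : seq letter) : Prop :=
  reduced_word u (neg_part w) /\ reduced_word v (pos_part w).

(* Here k is the 0-based position: letter k of the sequence w is i_{k+1}. *)
Definition u_ge (w : seq letter) (k : nat) := sprod (map oppl (rev (drop k w))).
Definition u_gt (w : seq letter) (k : nat) :=
  sprod (map oppl (rev (drop k.+1 w))).
Definition v_le (w : seq letter) (k : nat) := sprod (take k.+1 w).
Definition v_lt (w : seq letter) (k : nat) := sprod (take k w).

End Words.

Section Groups.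
Local Open Scope classical_set_scope.
Variables (F : unitRingType) (r : nat).
Local Notation M := 'M[F]_r.+1.
Implicit Types (x : M) (u v w : 'S_r.+1) (i : 'I_r).

Definition GL : set M := [set x | mxinvertible x].
Definition Bup : set M :=
  [set x | GL x /\ forall i j : 'I_r.+1, (j < i)%N -> x i j = 0].
Definition Blow : set M :=
  [set x | GL x /\ forall i j : 'I_r.+1, (i < j)%N -> x i j = 0].
Definition Hdiag : set M := [set x | GL x /\ is_diag_mx x].
Definition Uup : set M := [set x | Bup x /\ forall i : 'I_r.+1, x i i = 1].

(* u e_k = e_{u(k)}; this is the transpose of [perm_mx u]. *)
Definition perm_matrix u : M := \matrix_(i, j) (i == u j)%:R.

Definition dcoset (A : set M) (g : M) (B : set M) : set M :=
  [set a * g * b | a in A & b in B].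

(* phi_i of the 2 x 2 matrix with rows (a b) and (c d) *)
Definition phi i (a b c d : F) : M := \matrix_(p, q)
  if (p == lo i) && (q == lo i) then a
  else if (p == lo i) && (q == hi i) then b
  else if (p == hi i) && (q == lo i) then c
  else if (p == hi i) && (q == hi i) then d
  else (p == q)%:R.

Definition sbar i : M := phi i 0 (-1) 1 0.

(* The value is independent of the reduced word chosen. *)
Definition wbar w : M := \prod_(i <- xget [::] (reduced_word w)) sbar i.

(* x_{i}(t) and x_{-i}(t) *)
Definition xgen (a : letter r) (t : F) : M :=
  match a with
  | Pos i => phi i 1 t 0 1
  | Neg i => phi i t^-1 0 1 t
  end.

Definition Gcell u v : set M :=
  dcoset Bup (perm_matrix u) Bup `&` dcoset Blow (perm_matrix v) Blow.
Definition Lcell u v : set M :=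
  dcoset Uup (wbar u) Uup `&` dcoset Blow (perm_matrix v) Blow.

(* The pair ([x]_-, [x]_+), for x in B^- U. *)
Definition gauss x : M * M :=
  xget (1, 1) [set p : M * M | [/\ Blow p.1, Uup p.2 & x = p.1 * p.2]].
Definition gauss_minus x : M := (gauss x).1.
Definition gauss_plus x : M := (gauss x).2.

Definition Jsign : M := diag_mx (\row_(k < r.+1) (-1) ^+ k.+1).
Definition piota x : M := Jsign * mxinv x * Jsign.

Definition twistL u v x : M :=
  piota (gauss_minus (x * wbar v^-1%g)) * mxinv (piota x)
  * piota (gauss_plus (mxinv (wbar u) * x)).

(* The factorization x = h x' with h in H and x' in L^{u,v}, for x in
   G^{u,v}. *)
Definition Hfactor u v x : M * M :=
  xget (1, 1) [set p : M * M | [/\ Hdiag p.1, Lcell u v p.2 & x = p.1 * p.2]].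

Definition twist u v x : M :=
  (Hfactor u v x).1 * twistL u v (Hfactor u v x).2.

End Groups.

(* Main.v *)
Require Import Defs.
From HB Require Import structures.
From mathcomp Require Import all_boot all_order all_fingroup all_algebra.
From mathcomp Require Import zify.
From mathcomp Require boolp classical_sets.

(* Let D_p(z) denote the p-th diagonal entry of the lower triangular factor of
   z in B^- U. A Gauss factorization computes principal quasideterminants, and
   the signs in [Delta] are those of the representatives ubar, vbar, so
   Delta^p_{u,v}(y) = D_p(ubar^-1 y vbar).

   Split x' = P Q at position k, P being the product of the first k factors, and
   write b for [x' (v^-1)bar]_- and n for [ubar^-1 x']_+. The element
     c_k = P^-1 b g^-1,  g the lift of (v_{<=k})^-1,
   is lower triangular, and S_k = f n Q^-1, with f the product of the s_i-bar over
   the negative letters -i of Q, is upper unitriangular. Since psi(x') = (n x'^-1 b)^iota, this gives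
     (v_{<=k})bar^-1 psi(x') (u_{>k})bar = c_k^iota S_k^iota,
   so the quasiminors of y are the inverses of the diagonal entries of c_k, up to
   a factor from h. Passing from c_{k-1} to c_k is a 2 x 2 computation in rows
   i, i + 1, from which t_k is read off.

   Triangularity of c_k and of S_k^-1 are the same statement for the two
   opposite orders on the indices ([sandwichP]); it rests on the fact that in a
   reduced word no inversion is undone. *)

Set Implicit Arguments.
Unset Strict Implicit.
Unset Printing Implicit Defensive.
Import GRing.Theory.
Local Open Scope ring_scope.

(** * The unit ring of square matrices *)

(* An alias is needed: MathComp makes ['M[F]_r.+1] a unit ring only for
   commutative [F]. *)
Definition gmx (F : unitRingType) (r : nat) : Type := 'M[F]_r.+1.

Section MatrixUnits.
Variables (F : unitRingType) (r : nat).

HB.instance Definition _ := GRing.NzRing.copy (gmx F r) 'M[F]_r.+1.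

Definition gmx_unit : pred (gmx F r) :=
  [pred x : gmx F r | boolp.asbool (mxinvertible (x : 'M[F]_r.+1))].
Definition gmx_inv (x : gmx F r) : gmx F r :=
  if x \in gmx_unit then mxinv (x : 'M[F]_r.+1) else x.

Lemma is_mxinv_mxinv (p q : nat) (A : 'M[F]_(p, q)) :
  mxinvertible A -> is_mxinv A (mxinv A).
Proof. exact: classical_sets.xgetPex. Qed.

Lemma is_mxinv_uniq (p q : nat) (A : 'M[F]_(p, q)) B :
  is_mxinv A B -> mxinv A = B.
Proof.
move=> AB; have [_ CA] := is_mxinv_mxinv (ex_intro _ B AB).
by rewrite -[LHS]mulmx1 -AB.1 mulmxA CA mul1mx.
Qed.

Fact gmx_mulVr : {in gmx_unit, left_inverse 1 gmx_inv *%R}.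
Proof.
move=> x ux; rewrite /gmx_inv ux.
by move: ux; rewrite inE => /boolp.asboolP /is_mxinv_mxinv [].
Qed.

Fact gmx_divrr : {in gmx_unit, right_inverse 1 gmx_inv *%R}.
Proof.
move=> x ux; rewrite /gmx_inv ux.
by move: ux; rewrite inE => /boolp.asboolP /is_mxinv_mxinv [].
Qed.

Fact gmx_unitP (x y : gmx F r) : y * x = 1 /\ x * y = 1 -> x \in gmx_unit.
Proof. by case=> yx xy; rewrite inE; apply/boolp.asboolP; exists y. Qed.

Fact gmx_invr_out : {in [predC gmx_unit], gmx_inv =1 id}.
Proof. by move=> x; rewrite inE /= /gmx_inv => /negbTE->. Qed.

HB.instance Definition _ := GRing.NzRing_hasMulInverse.Build (gmx F r)
  gmx_mulVr gmx_divrr gmx_unitP gmx_invr_out.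

Lemma gmx_unitE (x : gmx F r) : GL (x : 'M[F]_r.+1) <-> x \is a GRing.unit.
Proof. by split=> [?|]; [apply/boolp.asboolP | move/boolp.asboolP]. Qed.

Lemma mxinvE (x : gmx F r) : x \is a GRing.unit -> mxinv (x : 'M[F]_r.+1) = x^-1.
Proof. by move=> ux; rewrite [RHS]/GRing.inv /= /gmx_inv ux. Qed.

End MatrixUnits.

(** * Reduced words *)

Section Words.
Variable r : nat.
Implicit Types (i : 'I_r) (a b c p q : 'I_r.+1) (l : seq (letter r)).

Lemma lo_lt_hi i : (lo i < hi i)%N.
Proof. by rewrite /lo /hi /= /bump. Qed.

Lemma lo_neq_hi i : lo i != hi i.
Proof. by rewrite -val_eqE neq_ltn lo_lt_hi. Qed.

Lemma hiE i : hi i = (lo i).+1 :> nat.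
Proof. by rewrite /lo /hi /= /bump. Qed.

(** The ranks of [p] and [q] are consecutive, so no third rank lies between them and exchanging them
    reverses only that one pair. *)
Lemma tperm_adj_lt (s : 'S_r.+1) p q b c : s q = (s p).+1 :> nat ->
  (s b < s c)%N -> (b, c) != (p, q) -> (s (tperm p q b) < s (tperm p q c))%N.
Proof.
have s_eq x y : s x = s y :> nat -> x = y by move/val_inj/perm_inj.
move=> s_pq lt_bc ne; have {}ne : ~ (b = p /\ c = q).
  by case=> bp cq; rewrite bp cq eqxx in ne.
case: tpermP => [bp|bq|bp bq]; case: tpermP => [cp|cq|cp cq]; subst=> //; try lia.
- by case: ne.
- have : s c <> s q :> nat by move/s_eq.
  by lia.
- have : s b <> s p :> nat by move/s_eq.
  by lia.
Qed.

Lemma sgen_sqr (x : letter r) : (sgen x * sgen x = 1)%g.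
Proof. by case: x => i /=; rewrite ?tperm2 ?mulg1. Qed.

Lemma sprod_cat l1 l2 : sprod (l1 ++ l2) = (sprod l2 * sprod l1)%g.
Proof. by elim: l1 => [|x l1 IH] /=; rewrite ?mulg1 // IH mulgA. Qed.

Lemma sprod_rev l : sprod (rev l) = (sprod l)^-1%g.
Proof.
elim: l => [|x l IH] /=; first by rewrite invg1.
rewrite rev_cons -cats1 sprod_cat IH /= mul1g invMg; congr (_ * _)%g.
by apply/eqP; rewrite eq_sym eq_invg_mul sgen_sqr.
Qed.

Lemma pos_part_cat l1 l2 : pos_part (l1 ++ l2) = pos_part l1 ++ pos_part l2.
Proof. exact: pmap_cat. Qed.

Lemma size_pos_part_rev l : size (pos_part (rev l)) = size (pos_part l).
Proof. by rewrite !size_pmap count_rev. Qed.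

Lemma sprod_pos_part l : sprod (map (@Pos r) (pos_part l)) = sprod l.
Proof. by elim: l => [|[i|i] l IH] //=; rewrite IH ?mulg1. Qed.

Lemma neg_partE l : neg_part l = pos_part (map (@oppl r) l).
Proof. by elim: l => [|[i|i] l IH] //=; rewrite -IH. Qed.

(** This is the exchange condition: the pair is followed through the word until a letter inverts it,
    and that letter is deleted. The letters passed on the way conjugate the transposition. *)
Lemma exchange l a b : (a < b)%N -> ((sprod l)^-1%g b < (sprod l)^-1%g a)%N ->
  exists l', sprod l' = (sprod l * tperm a b)%g /\
             (size (pos_part l') < size (pos_part l))%N.
Proof.
elim: l a b => [|[i|i] l IH] a b lt_ab /=.
- by rewrite invg1 !perm1 ltnNge ltnW.
- rewrite invMg tpermV !permM => lt_ba.
  have lt_tperm := @tperm_adj_lt 1%g (lo i) (hi i) a b.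
  rewrite !perm1 in lt_tperm; have {}lt_tperm := lt_tperm (hiE i).
  have [[-> ->]|ne] := eqVneq (a, b) (lo i, hi i).
    by exists l; rewrite -mulgA tperm2 mulg1.
  have [l' [l'E lt_l']] := IH _ _ (lt_tperm lt_ab ne) lt_ba.
  exists (Pos i :: l'); split=> //=.
  by rewrite l'E -tpermJ /conjg tpermV -!mulgA tperm2 mulg1.
- rewrite mulg1 => lt_ba; have [l' [l'E lt_l']] := IH _ _ lt_ab lt_ba.
  by exists l'.
Qed.

(** Letters [Neg] have length zero and act trivially, so a double word can be cut at any position
    without first extracting its positive subword; the word of u is reached through [oppl]. *)
Definition reduced l := forall l', sprod l' = sprod l ->
  (size (pos_part l) <= size (pos_part l'))%N.

Lemma reduced_wordP (w : 'S_r.+1) l :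
  reduced_word w (pos_part l) -> sprod l = w /\ reduced l.
Proof.
move=> [lw minl]; rewrite sprod_pos_part in lw; split=> // l' l'E.
by apply: minl; rewrite sprod_pos_part l'E.
Qed.

Lemma pos_part_Pos (s : seq 'I_r) : pos_part (map (@Pos r) s) = s.
Proof. by elim: s => //= i s {2}<-. Qed.

Lemma reduced_word_Pos (w : 'S_r.+1) (s : seq 'I_r) :
  reduced_word w s -> sprod (map (@Pos r) s) = w /\ reduced (map (@Pos r) s).
Proof. by rewrite -{1}(pos_part_Pos s) => /reduced_wordP. Qed.

Lemma reduced_is_word l : reduced l -> reduced_word (sprod l) (pos_part l).
Proof.
move=> red_l; split=> [|s /red_l]; first exact: sprod_pos_part.
by rewrite pos_part_Pos.
Qed.

Lemma reduced_catl l1 l2 : reduced (l1 ++ l2) -> reduced l1.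
Proof.
move=> red12 l' l'E; have := red12 (l' ++ l2).
rewrite !sprod_cat l'E => /(_ erefl).
by rewrite !pos_part_cat !size_cat leq_add2r.
Qed.

Lemma reduced_catr l1 l2 : reduced (l1 ++ l2) -> reduced l2.
Proof.
move=> red12 l' l'E; have := red12 (l1 ++ l').
rewrite !sprod_cat l'E => /(_ erefl).
by rewrite !pos_part_cat !size_cat leq_add2l.
Qed.

Lemma reduced_rev l : reduced l -> reduced (rev l).
Proof.
move=> red_l l'; rewrite sprod_rev => l'E.
have := red_l (rev l'); rewrite sprod_rev l'E invgK => /(_ erefl).
by rewrite !size_pos_part_rev.
Qed.

(** If the pair fell, [exchange] would give a word for [sprod (Pos i :: l)] shorter than [l]. *)
Lemma reduced_rising i l : reduced (Pos i :: l) ->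
  ((sprod l)^-1%g (lo i) < (sprod l)^-1%g (hi i))%N.
Proof.
move=> red_l; rewrite ltnNge leq_eqVlt negb_or val_eqE.
rewrite (inj_eq perm_inj) eq_sym lo_neq_hi /=; apply/negP.
move=> /(exchange (lo_lt_hi i)) [l' [l'E lt_l']].
have /= := red_l l' l'E; lia.
Qed.

Lemma reduced_rising_rev i l : reduced (rcons l (Pos i)) ->
  (sprod l (lo i) < sprod l (hi i))%N.
Proof.
move=> /reduced_rev; rewrite rev_rcons => /reduced_rising.
by rewrite sprod_rev invgK.
Qed.

End Words.

(** * Triangular and monomial matrices *)

Section Triangular.
Variables (F : unitRingType) (skewF : GRing.field_axiom F) (r : nat).
Local Notation M := (gmx F r).
Implicit Types (x y z a d e g : M) (p q b c : 'I_r.+1) (s t : 'S_r.+1).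

Lemma gmxME x y p q : (x * y) p q = \sum_c x p c * y c q.
Proof. exact: mxE. Qed.

Lemma gmx1E p q : (1 : M) p q = (p == q)%:R.
Proof. exact: mxE. Qed.

Lemma unitr_mul x y :
  x \is a GRing.unit -> y \is a GRing.unit -> x * y \is a GRing.unit.
Proof. by move=> ux uy; rewrite unitrMl. Qed.

Lemma unitr_invE x y : x * y = 1 -> y * x = 1 ->
  x \is a GRing.unit /\ x^-1 = y.
Proof.
move=> xy yx; have ux : x \is a GRing.unit by apply/unitrP; exists y.
by split=> //; apply: (mulrI ux); rewrite divrr.
Qed.

Lemma mulf_neq0_skew (k l : F) : k != 0 -> l != 0 -> k * l != 0.
Proof.
move=> /skewF uk nz_l; apply: contra nz_l => /eqP kl0.
by rewrite -[l](mulKr uk) kl0 mulr0.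
Qed.

(* [s] ranks the indices: lower triangular matrices for [s = 1], upper ones
   for [s = flip], and their conjugates by permutation matrices in general. *)
Definition tri s x : Prop := forall p q, (s p < s q)%N -> x p q = 0.
Definition unidiag x : Prop := forall p, x p p = 1.
Definition flip : 'S_r.+1 := perm (@rev_ord_inj r.+1).

Lemma flip_lt s p q : ((s * flip)%g p < (s * flip)%g q)%N = (s q < s p)%N.
Proof. by rewrite !permM !permE /=; case: (s p) (s q) => i ? [j ?] /=; lia. Qed.

Lemma flip1_lt p q : (flip p < flip q)%N = (q < p)%N.
Proof. by have := flip_lt 1 p q; rewrite !mul1g !perm1. Qed.

Lemma perm_neq_lt s p q : p != q -> (s p < s q)%N \/ (s q < s p)%N.
Proof.
move=> ne_pq; apply/orP; rewrite -neq_ltn val_eqE.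
by apply: contra ne_pq => /eqP/perm_inj ->.
Qed.

Lemma tri1 s : tri s 1.
Proof. by move=> p q; rewrite gmx1E; case: eqP => // ->; rewrite ltnn. Qed.

Lemma unidiag1 : unidiag 1.
Proof. by move=> p; rewrite gmx1E eqxx. Qed.

Lemma triM s x y : tri s x -> tri s y -> tri s (x * y).
Proof.
move=> tx ty p q lt_pq; rewrite gmxME big1 // => c _.
case: (ltnP (s p) (s c)) => [/tx->|le_cp]; first by rewrite mul0r.
by rewrite ty ?mulr0 // (leq_ltn_trans le_cp).
Qed.

Lemma triM_diag s x y p : tri s x -> tri s y -> (x * y) p p = x p p * y p p.
Proof.
move=> tx ty; rewrite gmxME (bigD1 p) //= big1 ?addr0 // => c ne_cp.
by have [/ty->|/tx->] := perm_neq_lt s ne_cp; rewrite ?mulr0 ?mul0r.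
Qed.

Lemma unidiagM s x y : tri s x -> tri s y -> unidiag x -> unidiag y ->
  unidiag (x * y).
Proof. by move=> tx ty dx dy p; rewrite (triM_diag p tx ty) dx dy mulr1. Qed.

(** Forward substitution in [x * x^-1 = 1], by increasing rank: the rows of lower rank already
    vanish where needed in the inverse, so only the diagonal term of [x] survives. *)
Lemma tri_inv s x : x \is a GRing.unit -> tri s x ->
  [/\ tri s x^-1, forall p, x p p != 0 & forall p, x^-1 p p = (x p p)^-1].
Proof.
move=> ux tx.
have inv_row p : x p p * x^-1 p p = 1 /\
    forall q, (s p < s q)%N -> x^-1 p q = 0.
  have [k] := ubnP (s p); elim: k p => // k IH p lt_pk.
  have rowE q : (s p <= s q)%N -> x p p * x^-1 p q = (p == q)%:R.
    move=> le_pq; rewrite -gmx1E -(divrr ux) gmxME (bigD1 p) //= big1 ?addr0 //.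
    move=> c /(perm_neq_lt s)[lt_cp|/tx->]; last by rewrite mul0r.
    rewrite (IH c _).2 ?mulr0 //; first exact: leq_trans lt_cp _.
    exact: leq_trans lt_cp le_pq.
  have xz1 : x p p * x^-1 p p = 1 by rewrite rowE ?eqxx.
  have xp_neq0 : x p p != 0.
    by apply: contra_eq_neq xz1 => ->; rewrite mul0r eq_sym oner_neq0.
  split=> // q lt_pq; apply: (mulrI (skewF xp_neq0)).
  rewrite rowE ?mulr0; last exact: ltnW.
  by case: eqP lt_pq => // ->; rewrite ltnn.
have x_neq0 p : x p p != 0.
  apply: contra_eq_neq (inv_row p).1 => ->.
  by rewrite mul0r eq_sym oner_neq0.
split=> // [p q|p]; first exact: (inv_row p).2.
apply: (mulrI (skewF (x_neq0 p))); rewrite divrr ?(inv_row p).1 //.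
exact: skewF.
Qed.

Lemma tri_flip_diag s x p q : tri s x -> tri (s * flip)%g x -> p != q ->
  x p q = 0.
Proof.
move=> tx tx'; have := tx' p q; rewrite flip_lt => {}tx'.
by case/(perm_neq_lt s); [apply: tx | apply: tx'].
Qed.

(** The quotient [d'^-1 * d = x' * x^-1] is triangular for both orders, hence diagonal, and the
    right-hand expression has unit diagonal. *)
Lemma tri_uniq s d d' x x' :
    d \is a GRing.unit -> d' \is a GRing.unit ->
    x \is a GRing.unit -> x' \is a GRing.unit ->
    tri s d -> tri s d' -> tri (s * flip)%g x -> tri (s * flip)%g x' ->
    unidiag x -> unidiag x' ->
  d * x = d' * x' -> d = d' /\ x = x'.
Proof.
move=> ud ud' ux ux' td td' tx tx' dx dx' eq_dx.
have eq_e : d'^-1 * d = x' * x^-1.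
  by apply: (mulIr ux); rewrite -mulrA eq_dx mulKr // mulrVK.
have [tx'' _ dxV] := tri_inv ux tx; have [td'' _ _] := tri_inv ud' td'.
have e1 : d'^-1 * d = 1.
  apply/matrixP => p q; rewrite [RHS]mxE; case: eqP => [<-|/eqP ne_pq].
    by rewrite eq_e (triM_diag _ tx' tx'') dx' mul1r dxV dx invr1.
  apply: tri_flip_diag (triM td'' td) _ ne_pq.
  by rewrite eq_e; apply: triM.
have dd' : d = d' by rewrite -(mulVKr ud' d) e1 mulr1.
by split=> //; apply: (mulrI ud); rewrite eq_dx dd'.
Qed.

(** Entries on the graph of [s] are left free, which covers signed lifts of permutations as well as
    diagonal matrices. *)
Definition mono s g : Prop := forall b c, b != s c -> g b c = 0.

Lemma mono_mull s g x b c : mono s g -> (g * x) (s b) c = g (s b) b * x b c.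
Proof.
move=> mg; rewrite gmxME (bigD1 b) //= big1 ?addr0 // => d ne_db.
by rewrite mg ?mul0r // (inj_eq perm_inj) eq_sym.
Qed.

Lemma mono_mulr s g x b c : mono s g -> (x * g) b c = x b (s c) * g (s c) c.
Proof.
move=> mg; rewrite gmxME (bigD1 (s c)) //= big1 ?addr0 // => d ne_dc.
by rewrite mg ?mulr0.
Qed.

Lemma mono_neq0 s g b : g \is a GRing.unit -> mono s g -> g (s b) b != 0.
Proof.
move=> ug mg; have := mono_mulr g^-1 b b mg; rewrite mulVr // gmx1E eqxx.
by apply: contra_eq_neq => ->; rewrite mulr0 oner_neq0.
Qed.

Lemma mono_inv s g : g \is a GRing.unit -> mono s g -> mono s^-1 g^-1.
Proof.
move=> ug mg b c ne_bc; have ne_bc' : (b == (s^-1)%g c) = false by apply/negbTE.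
have := mono_mulr g^-1 b ((s^-1)%g c) mg; rewrite mulVr // gmx1E ne_bc' permKV.
have := mono_neq0 ((s^-1)%g c) ug mg; rewrite permKV => /skewF ugc gc0.
by apply: (mulIr ugc); rewrite -gc0 mul0r.
Qed.

Lemma conj_mono s g x b c : g \is a GRing.unit -> mono s g ->
  (g^-1 * x * g) b c = (g (s b) b)^-1 * x (s b) (s c) * g (s c) c.
Proof.
move=> ug mg; apply: (mulrI (skewF (mono_neq0 b ug mg))).
rewrite -(mono_mull _ _ _ mg) -!mulrA (mulVKr ug) (mono_mulr _ _ _ mg).
by rewrite mulVKr //; apply/skewF/mono_neq0.
Qed.

Lemma tri_conj s t g x : g \is a GRing.unit -> mono s g -> tri t x ->
  tri (s * t)%g (g^-1 * x * g).
Proof.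
move=> ug mg tx b c; rewrite !permM => lt_bc.
by rewrite (conj_mono _ _ _ ug mg) tx // mulr0 mul0r.
Qed.

Lemma unidiag_conj s g x : g \is a GRing.unit -> mono s g -> unidiag x ->
  unidiag (g^-1 * x * g).
Proof.
move=> ug mg dx b; rewrite (conj_mono _ _ _ ug mg) dx mulr1 mulVr //.
exact/skewF/mono_neq0.
Qed.

Definition elem p q (k : F) : M :=
  \matrix_(b, c) ((b == c)%:R + (if (b == p) && (c == q) then k else 0)).

Lemma mul_elem x p q k b c :
  (x * elem p q k) b c = x b c + (if c == q then x b p * k else 0).
Proof.
rewrite gmxME; under eq_bigr => d _ do rewrite mxE mulrDr.
rewrite big_split /= (bigD1 c) //= eqxx mulr1 big1 ?addr0; last first.
  by move=> d /negbTE->; rewrite mulr0.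
congr (_ + _); rewrite (bigD1 p) //= eqxx /= big1 ?addr0.
  by case: eqP; rewrite ?mulr0.
by move=> d /negbTE->; rewrite mulr0.
Qed.

Lemma elemD p q k l : p != q -> elem p q k * elem p q l = elem p q (k + l).
Proof.
move=> ne_pq; apply/matrixP => b c; rewrite mul_elem !mxE (negbTE ne_pq) andbF.
rewrite addr0 -addrA; congr (_ + _).
by case: (c == q) (b == p) => [] []; rewrite /= ?mul1r ?mul0r ?addr0.
Qed.

Lemma elem0 p q : elem p q 0 = 1.
Proof. by apply/matrixP => b c; rewrite !mxE if_same addr0. Qed.

Lemma elem_unit p q k : p != q ->
  elem p q k \is a GRing.unit /\ (elem p q k)^-1 = elem p q (- k).
Proof.
move=> ne_pq.
by apply: unitr_invE; rewrite elemD // ?subrr ?addNr elem0.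
Qed.

Lemma tri_elem t p q k : (t q < t p)%N -> tri t (elem p q k).
Proof.
move=> lt_qp b c lt_bc; rewrite mxE; case: eqP lt_bc => [->|_]; rewrite ?ltnn //.
by case: ifP => [/andP[/eqP-> /eqP->]|_]; rewrite ?addr0 // ltnNge ltnW.
Qed.

Lemma unidiag_elem p q k : p != q -> unidiag (elem p q k).
Proof.
move=> ne_pq b; rewrite mxE eqxx; case: ifP; rewrite ?addr0 //.
by case/andP=> /eqP-> /eqP eq_pq; rewrite eq_pq eqxx in ne_pq.
Qed.

End Triangular.
Arguments flip {r}.

(** * Peeling a product of Bruhat layers *)

Section Chain.
Variables (F : unitRingType) (skewF : GRing.field_axiom F) (r : nat).
Local Notation M := (gmx F r).
Implicit Types (x y z a d e g : M) (p q b c : 'I_r.+1) (s t : 'S_r.+1).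

(** [a * d] leaves the triangular group only at [(p, q)]. Multiplication by [g] exchanges columns
    [p] and [q] up to scalars, which makes the diagonal entry at [p] nonzero; subtracting a multiple
    of column [p] from column [q] then clears the bad entry. *)
Lemma cross_elem s p q a d g : s q = (s p).+1 :> nat ->
    d \is a GRing.unit -> g \is a GRing.unit -> mono (tperm p q) g ->
    a p q != 0 ->
    (forall b c, (s b < s c)%N -> (b, c) != (p, q) -> a b c = 0) ->
    tri s d ->
  exists d' k, a * d * g = d' * elem p q k /\ tri s d'.
Proof.
move=> s_pq ud ug mg a_pq ta td.
have s_eq b c : s b = s c :> nat -> b = c by move/val_inj/perm_inj.
have ne_pq : p != q by apply/eqP=> pq; move: s_pq; rewrite pq; lia.
pose z := a * d; pose x := z * g.
have tz b c : (s b < s c)%N -> (b, c) != (p, q) -> z b c = 0.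
  move=> lt_bc ne_bc; rewrite /z gmxME big1 // => e _.
  have [/td->|le_ce] := ltnP (s e) (s c); first by rewrite mulr0.
  have [[eb ee]|ne_be] := eqVneq (b, e) (p, q); last first.
    by rewrite ta ?mul0r // (leq_trans lt_bc).
  by subst b e; case/eqP: ne_bc; congr (_, _); apply: s_eq; lia.
have z_pq : z p q != 0.
  rewrite /z gmxME (bigD1 q) //= big1 ?addr0.
    by have [_ dq _] := tri_inv skewF ud td; apply: mulf_neq0_skew.
  move=> e ne_eq; case: (perm_neq_lt s ne_eq) => [/td->|lt_qe].
    by rewrite mulr0.
  rewrite ta ?mul0r //; first by lia.
  by rewrite xpair_eqE (negbTE ne_eq) andbF.
have tx b c : (s b < s c)%N -> (b, c) != (p, q) -> x b c = 0.
  move=> lt_bc ne_bc; rewrite /x (mono_mulr _ _ _ mg).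
  suff -> : z b (tperm p q c) = 0 by rewrite mul0r.
  apply: tz; last first.
    apply/negP => /eqP[bp /eqP]; rewrite -{2}(tpermL p q) (inj_eq perm_inj).
    by move=> /eqP cp; rewrite bp cp ltnn in lt_bc.
  case: tpermP => [cp|cq|//]; first by rewrite cp in lt_bc; lia.
  have ne_bp : b != p by apply: contra ne_bc; rewrite cq => /eqP->.
  by case: (perm_neq_lt s ne_bp) => //; rewrite cq in lt_bc; lia.
have x_pp : x p p != 0.
  rewrite /x (mono_mulr _ _ _ mg) tpermL mulf_neq0_skew //.
  by have := mono_neq0 p ug mg; rewrite tpermL.
pose k := (x p p)^-1 * x p q.
exists (x * elem p q (- k)), k; split=> [|b c lt_bc].
  by rewrite -[RHS]mulrA elemD // addNr elem0 mulr1.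
rewrite mul_elem; have [cq|ne_cq] := eqVneq c q; last first.
  by rewrite addr0 tx // xpair_eqE (negbTE ne_cq) andbF.
have [->|ne_bp] := eqVneq b p.
  by rewrite cq mulrN /k mulrA divrr ?mul1r ?subrr //; apply: skewF.
rewrite !tx ?mul0r ?addr0 ?xpair_eqE ?(negbTE ne_bp) //.
by case: (perm_neq_lt s ne_bp) => //; rewrite cq in lt_bc; lia.
Qed.

(** Conjugation by [g] exchanges the indices [p] and [q]; the only entry that could violate the
    order lands at [(p, q)] and comes from [x q p]. *)
Lemma tri_conj_adj t p q g x : t q = (t p).+1 :> nat ->
  g \is a GRing.unit -> mono (tperm p q) g -> tri t x -> x q p = 0 ->
  tri t (g^-1 * x * g).
Proof.
move=> t_pq ug mg tx x_qp b c lt_bc; rewrite (conj_mono skewF _ _ _ ug mg).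
suff -> : x (tperm p q b) (tperm p q c) = 0 by rewrite mulr0 mul0r.
have [[-> ->]|ne_bc] := eqVneq (b, c) (p, q); first by rewrite tpermL tpermR.
exact/tx/tperm_adj_lt.
Qed.

(** A layer [(a, g, o)] multiplies by [a] on the left and by [g] on the right. [Some (p, q)] marks
    the position where [a] leaves the triangular group, [None] a layer that stays inside it. *)
Definition step : Type := M * M * option ('I_r.+1 * 'I_r.+1).
Implicit Types (l : seq step) (o : option ('I_r.+1 * 'I_r.+1)).

Definition step_perm o : 'S_r.+1 := if o is Some (p, q) then tperm p q else 1%g.

Definition step_ok s a g o : Prop :=
  [/\ a \is a GRing.unit, g \is a GRing.unit &
      if o is Some (p, q) then
        [/\ s q = (s p).+1 :> nat, mono (tperm p q) g, a p q != 0 &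
            forall b c, (s b < s c)%N -> (b, c) != (p, q) -> a b c = 0]
      else tri s a /\ g = 1].

Fixpoint suffix_rank s l : 'S_r.+1 :=
  if l is (_, _, o) :: l' then (step_perm o * suffix_rank s l')%g else s.

(** The form in which reducedness is used: seen through the later layers, each crossing pair still
    rises. [prefix_falling] is the counterpart for the layers already removed. *)
Fixpoint suffix_rising s l : Prop :=
  if l is (a, g, o) :: l' then
    [/\ step_ok s a g o,
        if o is Some (p, q) then (suffix_rank s l' p < suffix_rank s l' q)%N
        else True
      & suffix_rising s l']
  else True.

Fixpoint prefix_falling t l : Prop :=
  if l is (_, _, o) :: l' then
    (if o is Some (p, q) then (t q < t p)%N else True) /\
    prefix_falling (step_perm o * t)%g l'
  else True.

Fixpoint sandwich l : M :=
  if l is (a, g, _) :: l' then a * sandwich l' * g else 1.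

(** Records the triangularity of all matrices got by stripping the layers one after another. The
    unit diagonal of the last remnant is the starting point for computing other diagonals. *)
Fixpoint peeled s x l : Prop :=
  tri s x /\
  if l is (a, g, _) :: l' then peeled s (a^-1 * x * g^-1) l' else unidiag x.

(* The extra factor [e] is what makes the induction on [l] go through. *)
Lemma sandwichP s l : suffix_rising s l ->
  exists d x,
    [/\ sandwich l = d * x, d \is a GRing.unit, tri s d &
    [/\ x \is a GRing.unit, tri (s * flip)%g x, tri (suffix_rank s l) x,
        unidiag x &
    forall t e, prefix_falling t l -> tri s e -> tri t e -> unidiag e ->
      peeled s (d * e) l]].
Proof.
elim: l => [|[[a g] [[p q]|]] l IH] /=.
- move=> _; exists 1, 1; split; rewrite ?mulr1 ?unitr1 //; first exact: tri1.
  split; rewrite ?unitr1 //; try exact: tri1; first exact: unidiag1.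
  by move=> t e _ te _ de; rewrite mul1r.
- case=> [[ua ug [s_pq mg a_pq ta]] lt_pq].
  case/IH=> [d [x [lE ud td [ux tx tx' dx peel_d]]]].
  have ne_pq : p != q by apply/eqP=> pq; move: s_pq; rewrite pq; lia.
  have lt_s : (s p < s q)%N by lia.
  have [d' [k [d'E td']]] := cross_elem s_pq ud ug mg a_pq ta td.
  have [uy yV] := elem_unit k ne_pq.
  have ud' : d' \is a GRing.unit.
    have -> : d' = a * d * g * (elem p q k)^-1 by rewrite d'E mulrK.
    by rewrite yV; do ?apply: unitr_mul; rewrite ?(elem_unit _ ne_pq).1.
  have mgV : mono (tperm p q) g^-1.
    by have := mono_inv skewF ug mg; rewrite tpermV.
  have sK : ((tperm p q * (tperm p q * s)) = s)%g by rewrite mulgA tperm2 mul1g.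
  (* The rising condition enters here: conjugation by [g] moves this entry to [(q, p)], the one
     place where the flipped order could be violated. *)
  have x_pq : x p q = 0 by apply: tx'.
  have tconj : tri (s * flip)%g (g^-1 * x * g).
    apply: (@tri_conj_adj _ q p) => //; last by rewrite tpermC.
    by rewrite !permM !permE /= s_pq; have := ltn_ord (s q); lia.
  have ty : tri (s * flip)%g (elem p q k) by apply: tri_elem; rewrite flip_lt.
  (* The layer gives [a * (d * x) * g = (a * d * g) * (g^-1 * x * g)], and [cross_elem] splits
     [a * d * g]. *)
  exists d', (elem p q k * (g^-1 * x * g)); split=> //.
    by rewrite lE [RHS]mulrA -d'E !mulrA mulrK.
  split.
  + by do ?apply: unitr_mul; rewrite ?unitrV.
  + exact: triM.
  + apply: triM; last exact: tri_conj.
    by apply: tri_elem; rewrite !permM tpermL tpermR.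
  + apply: unidiagM ty tconj (unidiag_elem _ ne_pq) _.
    exact: (unidiag_conj skewF ug mg dx).
  move=> t e [lt_qp fall_t] te te' de; split; first exact: triM.
  (* Stripping the layer brings back [d] with a new factor in place of [e], to which the induction
     hypothesis applies. The falling condition makes the conjugated elementary matrix triangular for
     the new ranking, and it forces [e q p = 0]. *)
  have -> : a^-1 * (d' * e) * g^-1 =
      d * (g * (elem p q k)^-1 * g^-1 * (g * e * g^-1)).
    have -> : d' = a * d * g * (elem p q k)^-1 by rewrite d'E mulrK.
    by rewrite -!mulrA (mulKr ua) (mulKr ug).
  have ugV : g^-1 \is a GRing.unit by rewrite unitrV.
  have tc1 : tri (tperm p q * t)%g (g * (elem p q k)^-1 * g^-1).
    rewrite yV -{1}[g]invrK => b c; rewrite (conj_mono skewF _ _ _ ugV mgV).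
    rewrite mxE (inj_eq perm_inj) !permM => lt_bc.
    have -> : (b == c) = false by apply: contraTF lt_bc => /eqP->; rewrite ltnn.
    case: ifP => [/andP[/eqP bE /eqP cE]|]; last by rewrite addr0 mulr0 mul0r.
    by rewrite bE cE in lt_bc; lia.
  have tc1' : tri s (g * (elem p q k)^-1 * g^-1).
    rewrite yV -{1}[g]invrK -sK; apply: tri_conj => //.
    by apply: tri_elem; rewrite !permM tpermL tpermR.
  have tc2 : tri (tperm p q * t)%g (g * e * g^-1).
    by rewrite -{1}[g]invrK; apply: tri_conj.
  have tc2' : tri s (g * e * g^-1).
    rewrite -{1}[g]invrK; apply: tri_conj_adj s_pq _ _ _ _ => //.
    exact: te'.
  have dc1 : unidiag (g * (elem p q k)^-1 * g^-1).
    rewrite yV -{1}[g]invrK; exact: (unidiag_conj skewF ugV mgV (unidiag_elem _ ne_pq)).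
  have dc2 : unidiag (g * e * g^-1).
    by rewrite -{1}[g]invrK; exact: (unidiag_conj skewF ugV mgV de).
  apply: peel_d fall_t _ _ _; first exact: triM.
    exact: triM.
  exact: unidiagM tc1' tc2' dc1 dc2.
- case=> [[ua ug [ta g1]] _]; case/IH=> [d [x [lE ud td [ux tx tx' dx peel_d]]]].
  exists (a * d), x; rewrite g1 mulr1 mul1g lE mulrA; split=> //.
    exact: unitr_mul.
    exact: triM.
  split=> // t e [_]; rewrite mul1g => fall_t te te' de.
  split; first by do 2!apply: triM => //.
  by rewrite invr1 mulr1 -mulrA mulKr //; apply: peel_d fall_t _ _ _.
Qed.

End Chain.

(** * Quasideterminants of a Gauss factorization *)

Section QuasideterminantsLU.
Variables (F : unitRingType) (skewF : GRing.field_axiom F) (r : nat).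
Local Notation M := (gmx F r).
Implicit Types (x y z l n : M) (a b c d k p q : 'I_r.+1) (s u v : 'S_r.+1).

Lemma sum_lower_trunc x (f : 'I_r.+1 -> F) (m : nat) c : tri 1%g x -> (c < m)%N ->
  \sum_(a < r.+1 | (a < m)%N) x c a * f a = \sum_a x c a * f a.
Proof.
move=> tx lt_cm; rewrite big_mkcond; apply: eq_bigr => a _.
case: ltnP => // le_ma; rewrite tx ?mul0r // !perm1.
exact: leq_trans lt_cm le_ma.
Qed.

Lemma sum_upper_trunc x (f : 'I_r.+1 -> F) (m : nat) c : tri flip x -> (c < m)%N ->
  \sum_(a < r.+1 | (a < m)%N) f a * x a c = \sum_a f a * x a c.
Proof.
move=> tx lt_cm; rewrite big_mkcond; apply: eq_bigr => a _.
case: ltnP => // le_ma; rewrite tx ?mulr0 // flip1_lt.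
exact: leq_trans lt_cm le_ma.
Qed.

Lemma mem_image_below s k p : (p \in (s @: upto k) :\ s k) = (s^-1%g p < k)%N.
Proof.
rewrite !inE -{1 2}[p](permKV s) (inj_eq perm_inj) mem_imset; last exact: perm_inj.
by rewrite inE ltn_neqAle.
Qed.

Lemma sum_image_below s k (f : 'I_r.+1 -> F) :
  \sum_(i < #|(s @: upto k) :\ s k|) f (enum_val i) =
  \sum_(a < r.+1 | (a < k)%N) f (s a).
Proof.
rewrite -(big_enum_val f) (reindex_inj (@perm_inj _ s)).
by apply: eq_bigl => a; rewrite mem_image_below permK.
Qed.

Lemma card_image_upto s k : #|s @: upto k| = k.+1.
Proof.
rewrite card_imset; last exact: perm_inj.
rewrite -sum1_card; under eq_bigl do rewrite inE.
by rewrite (big_ord_narrow_leq (leq_ord k)) sum1_card card_ord.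
Qed.

(** The block of [z = l * n] on the indices below [k] is the product of the corresponding blocks of
    [l] and [n], so [G] inverts it. The quasideterminant is then a Schur complement, and of [z k k]
    only the summand [l k k * n k k] is left. *)
Lemma quasidet_LU y l n u v k :
    (forall a c, y (u a) (v c) = (l * n) a c) ->
    l \is a GRing.unit -> n \is a GRing.unit -> tri 1%g l -> tri flip n ->
  quasidet_def (u @: upto k) (v @: upto k) (u k) (v k) y /\
  quasidet (u @: upto k) (v @: upto k) (u k) (v k) y = l k k * n k k.
Proof.
move=> yE ul un tl tn.
have [tl' _ _] := tri_inv skewF ul tl; have [tn' _ _] := tri_inv skewF un tn.
pose z := l * n.
pose G b a := \sum_(c < r.+1 | (c < k)%N) n^-1 b c * l^-1 c a.
have zG a d : \sum_(b < r.+1 | (b < k)%N) z a b * G b d =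
    \sum_(c < r.+1 | (c < k)%N) l a c * l^-1 c d.
  under eq_bigr do rewrite mulr_sumr.
  rewrite exchange_big; apply: eq_bigr => c lt_ck.
  under eq_bigr do rewrite mulrA.
  by rewrite -mulr_suml sum_upper_trunc // -gmxME /z mulrK.
have lz c d : (c < k)%N ->
    \sum_(a < r.+1 | (a < k)%N) l^-1 c a * z a d = n c d.
  by move=> lt_ck; rewrite sum_lower_trunc // -gmxME /z mulKr.
have Gz b d : \sum_(a < r.+1 | (a < k)%N) G b a * z a d =
    \sum_(c < r.+1 | (c < k)%N) n^-1 b c * n c d.
  under eq_bigr do rewrite mulr_suml.
  rewrite exchange_big; apply: eq_bigr => c lt_ck.
  by under eq_bigr do rewrite -mulrA; rewrite -mulr_sumr lz.
pose N : 'M[F]_(#|(v @: upto k) :\ v k|, #|(u @: upto k) :\ u k|) :=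
  \matrix_(j, i) G (v^-1%g (enum_val j)) (u^-1%g (enum_val i)).
have NP : is_mxinv (submx_of ((u @: upto k) :\ u k) ((v @: upto k) :\ v k) y) N.
  split; apply/matrixP => i j; rewrite !mxE.
  - under eq_bigr do rewrite !mxE.
    have := enum_valP i; have := enum_valP j; rewrite !mem_image_below.
    rewrite -(inj_eq enum_val_inj); move: (enum_val i) (enum_val j) => p q ltq ltp.
    rewrite -[p](permKV u); move: (u^-1%g p) ltp => {}p ltp.
    rewrite (sum_image_below v k (fun j => y (u p) j * G (v^-1%g j) (u^-1%g q))).
    under eq_bigr do rewrite yE permK.
    rewrite zG sum_lower_trunc // -gmxME divrr // gmx1E.
    by rewrite -{2}[q](permKV u) (inj_eq perm_inj).
  - under eq_bigr do rewrite !mxE.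
    have := enum_valP i; have := enum_valP j; rewrite !mem_image_below.
    rewrite -(inj_eq enum_val_inj); move: (enum_val i) (enum_val j) => p q ltq ltp.
    rewrite -[q](permKV v); move: (v^-1%g q) ltq => {}q ltq.
    rewrite (sum_image_below u k (fun j => G (v^-1%g p) (u^-1%g j) * y j (v q))).
    under eq_bigr do rewrite yE permK.
    rewrite Gz sum_upper_trunc // -gmxME mulVr // gmx1E.
    by rewrite -{2}[p](permKV v) (inj_eq perm_inj).
have zkk : z k k = \sum_(c < r.+1 | (c < k)%N) l k c * n c k + l k k * n k k.
  rewrite /z gmxME (bigD1 k) //= addrC; congr (_ + _).
  rewrite big_mkcond [RHS]big_mkcond; apply: eq_bigr => c _.
  rewrite -val_eqE ltn_neqAle; case: eqP => //= _; case: leqP => // lt_kc.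
  by rewrite tl ?mul0r ?perm1.
split.
  split; rewrite ?card_image_upto //; try by rewrite imset_f // inE.
  by right; exists N.
rewrite /quasidet card_image_upto yE -/z; case: eqP => [[k0]|_].
  rewrite zkk big1 ?add0r // => c; lia.
rewrite (is_mxinv_uniq NP) zkk; apply/eqP; rewrite subr_eq addrC; apply/eqP.
congr (_ + _); rewrite mxE.
(* Row [k] is outside the block, so with [G] it yields only the product of [l] and [l^-1] truncated
   below [k]; [lz] then turns column [k] of [z] into column [k] of [n]. *)
transitivity (\sum_(a < r.+1 | (a < k)%N)
    (\sum_(c < r.+1 | (c < k)%N) l k c * l^-1 c a) * z a k).
  under [RHS]eq_bigr do rewrite mulr_suml.
  rewrite exchange_big; apply: eq_bigr => c lt_ck.
  by under eq_bigr do rewrite -mulrA; rewrite -mulr_sumr lz.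
under [RHS]eq_bigr do rewrite !mxE.
rewrite (eq_bigr (fun i => (\sum_(b < r.+1 | (b < k)%N)
    z k b * G b (u^-1%g (enum_val i))) * y (enum_val i) (v k))); last first.
  move=> i _; congr (_ * _); under eq_bigr do rewrite !mxE.
  rewrite (sum_image_below v k (fun j => y (u k) j * G (v^-1%g j) _)).
  by apply: eq_bigr => b _; rewrite yE permK.
rewrite (sum_image_below u k (fun j => (\sum_(b < r.+1 | (b < k)%N)
    z k b * G b (u^-1%g j)) * y j (v k))).
by apply: eq_bigr => a _; rewrite yE permK zG.
Qed.

End QuasideterminantsLU.

(** * Signed permutation matrices *)

Section SignedPermutations.
Variables (F : unitRingType) (skewF : GRing.field_axiom F) (r : nat).
Local Notation M := (gmx F r).
Implicit Types (x y z l n : M) (k p q : 'I_r.+1) (i : 'I_r) (u v w : 'S_r.+1).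

(** The number of inversions of [w] ending at position [k], which is the sign exponent that [Delta]
    attaches to either index set. *)
Definition inv_at w k : nat := above (w k) (w @: upto k).

Lemma inv_atE w k :
  inv_at w k = #|[set p : 'I_r.+1 | (p < k)%N && (w k < w p)%N]|.
Proof.
rewrite -(card_imset _ (@perm_inj _ w)) /inv_at /above.
congr #|pred_of_set _|; apply/setP => p.
rewrite !inE -[p](permKV w) !mem_imset ?inE ?permK; try exact: perm_inj.
move: (w^-1%g p) => {}p; case: (ltngtP p k) => // /ord_inj->.
by rewrite ltnn.
Qed.

(** Closed form of the lift of [w], see [wbarE]; its signs are those occurring in [Delta]. *)
Definition sgnmx w : M := \matrix_(p, q) if p == w q then (-1) ^+ inv_at w q else 0.

Lemma mono_sgnmx w : mono w (sgnmx w).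
Proof. by move=> p q /negbTE ne_pq; rewrite mxE ne_pq. Qed.

Lemma sgnmx_graph w q : sgnmx w (w q) q = (-1) ^+ inv_at w q.
Proof. by rewrite mxE eqxx. Qed.

(** Swapping two adjacent values changes the relative order of their own two positions only. The
    value [lo i] comes first, so the new inversion ends where [hi i] stood. *)
Lemma inv_at_adj w i q : (w^-1%g (lo i) < w^-1%g (hi i))%N ->
  inv_at (w * tperm (lo i) (hi i))%g q = ((w q == hi i) + inv_at w q)%N.
Proof.
move=> lt_w; have hiE := hiE i; rewrite !inv_atE.
have neq_val (p c : 'I_r.+1) : p != c -> p <> c :> nat.
  by move=> ne /ord_inj pc; rewrite pc eqxx in ne.
have wE p (c : 'I_r.+1) : (w p == c) = (p == w^-1%g c).
  by rewrite -{1}[c](permKV w) (inj_eq perm_inj).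
have [wq|ne_wq] := eqVneq (w q) (hi i).
  have qE : q = w^-1%g (hi i) by rewrite -wq permK.
  transitivity #|w^-1%g (lo i) |: [set p : 'I_r.+1 | (p < q)%N && (w q < w p)%N]|.
    apply: eq_card => p; rewrite !inE !permM wq tpermR -wE.
    case: tpermP => [wp|wp|/eqP ne1 /eqP ne2].
    - rewrite wp eqxx orTb andbC lo_lt_hi andTb qE.
      by move/eqP: wp; rewrite wE => /eqP->.
    - by rewrite wp !ltnn !andbF orbF eq_sym (negbTE (lo_neq_hi i)).
    - rewrite (negbTE ne1) orFb; congr (_ && _).
      by move/neq_val: ne2; lia.
  have lt_hl : (hi i < lo i)%N = false by lia.
  by rewrite cardsU1 !inE wq permKV lt_hl andbF.
rewrite add0n; apply: eq_card => p; rewrite !inE !permM.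
have [lt_pq|//] := ltnP p q; rewrite !andTb.
case: (tpermP _ _ (w q)) => [wq|wq|/eqP ne1 _].
- case: tpermP => [wp|wp|/eqP ne3 /eqP ne4].
  + by rewrite wq wp !ltnn.
  + move: lt_pq; have /eqP := wp; rewrite wE => /eqP->.
    by have /eqP := wq; rewrite wE => /eqP->; rewrite ltnNge ltnW.
  + by rewrite wq; move/neq_val: ne4; lia.
- by rewrite wq eqxx in ne_wq.
- move/neq_val: ne1; move/neq_val: ne_wq.
  by case: tpermP => [->|->|//]; lia.
Qed.

Lemma sgnmx1 : sgnmx 1 = 1.
Proof.
apply/matrixP => p q; rewrite !mxE perm1; case: eqP => // _.
rewrite inv_atE (eq_card (B := pred0)) ?card0 // => c.
by rewrite !inE !perm1; case: ltngtP.
Qed.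

Lemma phi_mull i (a b c d : F) x p q : ((phi i a b c d : M) * x) p q =
  if p == lo i then a * x (lo i) q + b * x (hi i) q
  else if p == hi i then c * x (lo i) q + d * x (hi i) q else x p q.
Proof.
have ne_hl : hi i != lo i by rewrite eq_sym lo_neq_hi.
have [p_lh|p_lh] := boolP (p \in [:: lo i; hi i]).
  rewrite gmxME (bigD1 (lo i)) // (bigD1 (hi i)) //= !mxE addrA big1 ?addr0.
    move: p_lh; rewrite !inE => /orP[]/eqP->;
    by rewrite !eqxx ?(negbTE ne_hl) ?(negbTE (lo_neq_hi i)).
  move=> e /andP[/negbTE el /negbTE eh]; rewrite !mxE el eh !andbF.
  by move: p_lh; rewrite !inE => /orP[]/eqP->; rewrite eq_sym ?el ?eh mul0r.
move: p_lh; rewrite !inE negb_or => /andP[/negbTE pl /negbTE ph].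
rewrite pl ph gmxME (bigD1 p) //= !mxE pl ph eqxx mul1r big1 ?addr0 //.
by move=> e /negbTE ep; rewrite !mxE pl ph /= eq_sym ep mul0r.
Qed.

Lemma phi_mulr i (a b c d : F) x p q : (x * (phi i a b c d : M)) p q =
  if q == lo i then x p (lo i) * a + x p (hi i) * c
  else if q == hi i then x p (lo i) * b + x p (hi i) * d else x p q.
Proof.
have ne_hl : hi i != lo i by rewrite eq_sym lo_neq_hi.
have [q_lh|q_lh] := boolP (q \in [:: lo i; hi i]).
  rewrite gmxME (bigD1 (lo i)) // (bigD1 (hi i)) //= !mxE addrA big1 ?addr0.
    move: q_lh; rewrite !inE => /orP[]/eqP->;
    by rewrite !eqxx ?(negbTE ne_hl) ?(negbTE (lo_neq_hi i)) ?andbF.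
  move=> e /andP[/negbTE el /negbTE eh]; rewrite !mxE el eh /=.
  by move: q_lh; rewrite !inE => /orP[]/eqP->; rewrite ?el ?eh mulr0.
move: q_lh; rewrite !inE negb_or => /andP[/negbTE ql /negbTE qh].
rewrite ql qh gmxME (bigD1 q) //= !mxE ql qh !andbF eqxx mulr1 big1 ?addr0 //.
by move=> e /negbTE ep; rewrite !mxE ql qh !andbF ep mulr0.
Qed.

Lemma phiM i (a b c d a' b' c' d' : F) :
  (phi i a b c d : M) * phi i a' b' c' d' =
  phi i (a * a' + b * c') (a * b' + b * d') (c * a' + d * c') (c * b' + d * d').
Proof.
have ne_hl : hi i != lo i by rewrite eq_sym lo_neq_hi.
apply/matrixP => p q; rewrite phi_mull !mxE !eqxx (negbTE ne_hl).
rewrite (negbTE (lo_neq_hi i)) /= [lo i == q]eq_sym [hi i == q]eq_sym.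
have [->|pl] := eqVneq p (lo i).
  rewrite (negbTE (lo_neq_hi i)) [lo i == q]eq_sym /=.
  have [//|ql] := eqVneq q (lo i); have [//|qh] := eqVneq q (hi i).
  by rewrite !mulr0 addr0.
have [->|ph] := eqVneq p (hi i) => //=.
rewrite [hi i == q]eq_sym.
have [//|ql] := eqVneq q (lo i); have [//|qh] := eqVneq q (hi i).
by rewrite !mulr0 addr0.
Qed.

Lemma phi1 i : (phi i 1 0 0 1 : M) = 1.
Proof.
apply/matrixP => p q; rewrite mxE gmx1E.
have [->|pl] := eqVneq p (lo i).
  rewrite (negbTE (lo_neq_hi i)) [lo i == q]eq_sym /=.
  by have [//|ql] := eqVneq q (lo i); case: eqP.
have [->|ph] := eqVneq p (hi i) => //=; rewrite [hi i == q]eq_sym.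
have [->|ql] := eqVneq q (lo i); first by rewrite (negbTE (lo_neq_hi i)).
by case: eqP.
Qed.

Lemma sbar_inv i : (sbar F i : M) \is a GRing.unit /\
  (sbar F i : M)^-1 = phi i 0 1 (-1) 0.
Proof.
apply: unitr_invE; rewrite phiM.
all: rewrite !(mulr0, mul0r, mul1r, mulr1, mulN1r, addr0, add0r, opprK).
all: exact: phi1.
Qed.

(** The entry -1 of [sbar] acts on the column whose value is [hi i], which by [inv_at_adj] is the
    only one to gain an inversion. *)
Lemma sbar_sgnmx w i : (w^-1%g (lo i) < w^-1%g (hi i))%N ->
  (sbar F i : M) * sgnmx w = sgnmx (w * tperm (lo i) (hi i))%g.
Proof.
move=> lt_w; have ne_hl : hi i != lo i by rewrite eq_sym lo_neq_hi.
apply/matrixP => p q; rewrite phi_mull !mxE inv_at_adj // permM.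
rewrite !mul0r add0r addr0 mul1r.
case: tpermP => [wq|wq|/eqP nl /eqP nh].
- rewrite wq (negbTE (lo_neq_hi i)) (negbTE ne_hl) mulr0 eqxx.
  by case: (eqVneq p (lo i)) => [->|pl]; rewrite ?(negbTE (lo_neq_hi i)) //;
     case: eqP.
- rewrite wq !eqxx (negbTE (lo_neq_hi i)).
  by case: eqP => [_|//]; [rewrite add1n exprS | do 2!case: eqP => //].
- rewrite (negbTE nh) ![_ == w q]eq_sym (negbTE nh) (negbTE nl) mulr0.
  case: (eqVneq p (lo i)) => [->|pl]; first by rewrite (negbTE nl).
  by case: (eqVneq p (hi i)) => [->|ph] //; rewrite (negbTE nh).
Qed.

(** By [reduced_rising] every positive letter adds one inversion, so the signs agree at each stage.
    The outcome depends only on the permutation, whichever reduced word [wbar] picks. *)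
Lemma prod_sbar (l : seq (letter r)) : reduced l ->
  \prod_(i <- pos_part l) (sbar F i : M) = sgnmx (sprod l).
Proof.
elim: l => [|[i|i] l IH] red_l /=; first by rewrite big_nil sgnmx1.
  rewrite big_cons IH; last exact: (@reduced_catr _ [:: Pos i]).
  by rewrite sbar_sgnmx //; apply: reduced_rising.
by rewrite mulg1 IH //; apply: (@reduced_catr _ [:: Neg i]).
Qed.

Lemma wbarE (l : seq (letter r)) : reduced l ->
  wbar F (sprod l) = sgnmx (sprod l).
Proof.
move=> red_l; rewrite /wbar.
have /(classical_sets.xgetPex [::]) : exists s, reduced_word (sprod l) s.
  by exists (pos_part l); apply: reduced_is_word.
move: (classical_sets.xget _ _) => s /reduced_word_Pos[<- red_s].
by rewrite -prod_sbar // pos_part_Pos.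
Qed.

Lemma sgnmx_unit (l : seq (letter r)) : reduced l ->
  sgnmx (sprod l) \is a GRing.unit.
Proof.
move=> red_l; rewrite -prod_sbar //.
apply: (big_ind (fun x : M => x \is a GRing.unit)); rewrite ?unitr1 //.
  exact: unitr_mul.
by move=> i _; have [] := sbar_inv i.
Qed.

(* [Delta k u v] is the [k]-th principal quasiminor of [ubar^-1 * y * vbar]. *)
Lemma Delta_LU y l n u v k :
    y * sgnmx v = sgnmx u * (l * n) ->
    l \is a GRing.unit -> n \is a GRing.unit -> tri 1%g l -> tri flip n ->
    unidiag n ->
  Delta_def k u v y /\ Delta k u v y = l k k.
Proof.
move=> yE ul un tl tn dn.
(* Diagonal signs separating [sgnmx] from the unsigned permutation matrix. They scale the rows and
   columns of [l * n] and cancel the sign in [qminor]. *)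
pose sd w : M := \matrix_(p, q) if p == q then (-1) ^+ inv_at w p else 0.
have sdE w p q : sd w p q = if p == q then (-1) ^+ inv_at w p else 0 by rewrite mxE.
have sd_mono w : mono 1%g (sd w).
  by move=> p q; rewrite perm1 sdE => /negbTE->.
have sd_tri s w : tri s (sd w).
  by move=> p q lt_pq; rewrite sdE; case: eqP lt_pq => // ->; rewrite ltnn.
have sdl w x p q : (sd w * x) p q = (-1) ^+ inv_at w p * x p q.
  by have := mono_mull x p q (sd_mono w); rewrite perm1 sdE eqxx.
have sdr w x p q : (x * sd w) p q = x p q * (-1) ^+ inv_at w q.
  by have := mono_mulr x p q (sd_mono w); rewrite perm1 sdE eqxx.
have sdK w : sd w * sd w = 1.
  apply/matrixP => p q; rewrite sdl sdE gmx1E; case: eqP => // _.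
    by rewrite -signr_odd -expr2 sqrr_sign.
  by rewrite mulr0.
have sdu w : sd w \is a GRing.unit by apply/unitrP; exists (sd w).
have entryE p q : y (u p) (v q) = (sd u * l * (n * sd v)) p q.
  rewrite mulrA sdr -mulrA sdl; have := congr1 (fun z : M => z (u p) q) yE.
  rewrite (mono_mulr _ _ _ (@mono_sgnmx v)) (mono_mull _ _ _ (@mono_sgnmx u)).
  rewrite !sgnmx_graph => <-.
  by rewrite -mulrA -expr2 sqrr_sign mulr1.
have [] := quasidet_LU skewF k entryE (unitr_mul (sdu u) ul)
  (unitr_mul un (sdu v)) (triM (sd_tri _ u) tl) (triM tn (sd_tri _ v)).
move=> defD qE; split=> //.
rewrite /Delta /qminor -/(inv_at u k) -/(inv_at v k) qE sdl sdr dn.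
rewrite exprD -(signr_odd _ (inv_at u k)) -(signr_odd _ (inv_at v k)).
by do 2!case: odd; rewrite !(expr0, expr1, mulN1r, mulrN1, mul1r, mulr1,
  mulNr, mulrN, opprK).
Qed.

End SignedPermutations.

(** * Cells and Gauss decomposition *)

Section BruhatCells.
Variables (F : unitRingType) (skewF : GRing.field_axiom F) (r : nat).
Local Notation M := (gmx F r).
Implicit Types (x y z d n : M) (p q : 'I_r.+1) (i : 'I_r) (u v w : 'S_r.+1).

Lemma BlowP x : Blow x <-> x \is a GRing.unit /\ tri 1%g x.
Proof.
split=> [[/gmx_unitE ux tx]|[ux tx]].
  by split=> // p q; rewrite !perm1; apply: tx.
split; first exact/gmx_unitE.
by move=> p q lt_pq; rewrite tx ?perm1.
Qed.

Lemma BupP x : Bup x <-> x \is a GRing.unit /\ tri flip x.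
Proof.
split=> [[/gmx_unitE ux tx]|[ux tx]].
  by split=> // p q; rewrite flip1_lt; apply: tx.
split; first exact/gmx_unitE.
by move=> p q lt_pq; rewrite tx ?flip1_lt.
Qed.

Lemma UupP x : Uup x <-> [/\ x \is a GRing.unit, tri flip x & unidiag x].
Proof.
split=> [[/BupP[ux tx] dx]|[ux tx dx]]; split=> //.
exact/BupP.
Qed.

Lemma gaussE d n : d \is a GRing.unit -> n \is a GRing.unit ->
  tri 1%g d -> tri flip n -> unidiag n -> gauss (d * n : M) = (d, n).
Proof.
move=> ud un td tn dn; rewrite /gauss.
have /(classical_sets.xgetPex (1, 1)) : exists p : M * M,
    [/\ Blow p.1, Uup p.2 & (d * n : 'M[F]_r.+1) = p.1 * p.2].
  by exists (d, n); split; [exact/BlowP | exact/UupP | ].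
case: (classical_sets.xget _ _) => d' n' [/BlowP[ud' td'] /UupP[un' tn' dn'] dn_eq].
have [-> ->] // : d = d' /\ n = n'.
by apply: (@tri_uniq _ skewF _ 1%g); rewrite ?mul1g.
Qed.

Lemma tri_diag_mx s (h : 'I_r.+1 -> F) : tri s (diag_mx (\row_p h p) : M).
Proof. by move=> p q lt_pq; rewrite !mxE; case: eqP lt_pq => // ->; rewrite ltnn. Qed.

Lemma diag_mx_diag (h : 'I_r.+1 -> F) p : (diag_mx (\row_p h p) : M) p p = h p.
Proof. by rewrite !mxE eqxx. Qed.

Lemma diag_mx_sgnmx (h : 'I_r.+1 -> F) w :
  (diag_mx (\row_p h p) : M) * sgnmx F w =
  sgnmx F w * diag_mx (\row_p h (w p)).
Proof.
apply/matrixP => p q; rewrite (mono_mulr _ _ _ (@mono_sgnmx F r w)) sgnmx_graph.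
rewrite !mxE -[p](permKV w).
have := @mono_mull F r w (sgnmx F w) (diag_mx (\row_p h (w p))) (w^-1%g p) q.
move/(_ (@mono_sgnmx F r w)); rewrite -gmxME sgnmx_graph => ->.
rewrite !mxE (inj_eq perm_inj); case: eqP => [->|_].
  by rewrite !mulr1n -(commr_sign (h _)).
by rewrite !mulr0n mul0r mulr0.
Qed.

Definition Jg : M := Jsign F r.

Lemma JgE p q : Jg p q = if p == q then (-1) ^+ p.+1 else 0.
Proof. by rewrite !mxE; case: eqP => [->|//]; rewrite mulr1n. Qed.

Lemma Jg_mono : mono 1%g Jg.
Proof. by move=> p q; rewrite perm1 JgE => /negbTE->. Qed.

Lemma Jg_sqr : Jg * Jg = 1.
Proof.
apply/matrixP => p q; have := mono_mulr Jg p q Jg_mono.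
rewrite perm1 !JgE eqxx gmx1E => ->; case: eqP => [->|_]; last by rewrite mul0r.
by rewrite -expr2 sqrr_sign.
Qed.

Lemma Jg_unit : Jg \is a GRing.unit.
Proof. by apply/unitrP; exists Jg; rewrite Jg_sqr. Qed.

Lemma Jg_inv : Jg^-1 = Jg.
Proof. by apply: (mulrI Jg_unit); rewrite divrr ?Jg_unit // Jg_sqr. Qed.

Lemma Jg_conj x p q : (Jg * x * Jg) p q = (-1) ^+ (p + q) * x p q.
Proof.
rewrite -{1}Jg_inv (conj_mono skewF _ _ _ Jg_unit Jg_mono) !perm1 !JgE !eqxx.
rewrite -[((-1) ^+ _)^-1]/(((-1) ^+ p.+1)^-1) -exprVn invrN invr1 -mulrA.
by rewrite (commr_sign (x p q) q.+1) mulrA -exprD addSn addnS !exprS !mulN1r opprK.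
Qed.

Lemma Jg_conj_diag x p : (Jg * x * Jg) p p = x p p.
Proof. by rewrite Jg_conj exprD -expr2 sqrr_sign mul1r. Qed.

Lemma tri_Jg_conj s x : tri s x -> tri s (Jg * x * Jg).
Proof. by move=> tx p q lt_pq; rewrite Jg_conj tx ?mulr0. Qed.

Lemma Jg_conjM x y : Jg * (x * y) * Jg = Jg * x * Jg * (Jg * y * Jg).
Proof. by rewrite -!mulrA [Jg * (Jg * _)]mulrA Jg_sqr mul1r. Qed.

Lemma Jg_conj_unit x : x \is a GRing.unit -> Jg * x * Jg \is a GRing.unit.
Proof. by move=> ux; do ?apply: unitr_mul; rewrite ?Jg_unit. Qed.

Lemma piotaE x : x \is a GRing.unit -> piota x = Jg * x^-1 * Jg.
Proof. by move=> ux; rewrite /piota mxinvE. Qed.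

Lemma is_diag_tri s x : is_diag_mx (x : 'M[F]_r.+1) -> tri s x.
Proof.
move=> dx p q lt_pq; apply: (is_diag_mxP dx).
by apply: contraTneq lt_pq => /ord_inj->; rewrite ltnn.
Qed.

Lemma Lcell_UuU u v x : wbar F u = sgnmx F u -> Lcell u v x ->
  exists a b : M, [/\ x = a * sgnmx F u * b,
    [/\ a \is a GRing.unit, tri flip a & unidiag a] &
    [/\ b \is a GRing.unit, tri flip b & unidiag b]].
Proof.
move=> uE [[a /UupP Ua [b /UupP Ub <-]] _].
by exists (a : M), (b : M); split=> //; rewrite -uE.
Qed.

(** With both elements written in U ubar U, the diagonal quotient [e] satisfies
    [g^-1 * (a'^-1 * (e * a)) * g = b' * b^-1]. The right side has unit diagonal, and the left side
    has the diagonal of [e], permuted and conjugated by signs, so [e = 1]. *)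
Lemma Hfactor_uniq u v (d d' x x' : M) :
    wbar F u = sgnmx F u -> sgnmx F u \is a GRing.unit ->
    Hdiag d -> Hdiag d' -> Lcell u v x -> Lcell u v x' ->
  d * x = d' * x' -> d = d' /\ x = x'.
Proof.
move=> uE uu [/gmx_unitE ud dd] [/gmx_unitE ud' dd'] Lx Lx' eq_dx.
suff dd1 : d = d' by split=> //; apply: (mulrI ud); rewrite eq_dx dd1.
have [a [b [xE [ua ta da] [ub tb db]]]] := Lcell_UuU uE Lx.
have [a' [b' [xE' [ua' ta' da'] [ub' tb' db']]]] := Lcell_UuU uE Lx'.
move: eq_dx; rewrite xE xE'; pose g := sgnmx F u; rewrite -/g => eq_dx.
pose e := d'^-1 * d.
have te s : tri s e.
  by apply: triM; [have [] := tri_inv skewF ud' (is_diag_tri (s := s) dd')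
                 | apply: is_diag_tri].
have [taV _ daV] := tri_inv skewF ua' ta'; have [tbV _ dbV] := tri_inv skewF ub tb.
have eq_e : g^-1 * (a'^-1 * (e * a)) * g = b' * b^-1.
  apply: (mulIr ub); rewrite (mulrVK ub) -!mulrA.
  apply: (mulrI uu); rewrite (mulVKr uu); apply: (mulrI ua'); rewrite (mulVKr ua').
  apply: (mulrI ud'); rewrite (mulVKr ud').
  by move: eq_dx; rewrite -!mulrA.
have e_diag p : e p p = 1.
  have := congr1 (fun z : M => z (u^-1%g p) (u^-1%g p)) eq_e.
  rewrite (conj_mono skewF _ _ _ uu (@mono_sgnmx F r u)) permKV.
  rewrite (triM_diag _ taV (triM (te flip) ta)) (triM_diag _ (te flip) ta).
  rewrite (triM_diag _ tb' tbV) daV dbV da da' db db' invr1 !mulr1 mul1r => geg.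
  have /= ugp := skewF (mono_neq0 (u^-1%g p) uu (@mono_sgnmx F r u)).
  rewrite permKV in ugp.
  by apply: (mulIr ugp); rewrite mul1r -[LHS](mulVKr ugp) [_^-1 * _]mulrA geg mulr1.
have e1 : e = 1.
  apply/matrixP => p q; rewrite [RHS]gmx1E; case: eqP => [<-//|/eqP].
  exact: tri_flip_diag (te 1%g) (te _).
by rewrite -(mulVKr ud' d) -/e e1 mulr1.
Qed.

End BruhatCells.

(** * Words as products of layers *)

Section PeeledWords.
Variables (F : unitRingType) (skewF : GRing.field_axiom F) (r : nat).
Local Notation M := (gmx F r).
Implicit Types (x y z d n : M) (p q b c : 'I_r.+1) (i : 'I_r) (u v w : 'S_r.+1).
Implicit Types (l : seq (letter r * M)) (o : bool).

Definition bar (a : letter r) : M := if a is Pos i then sbar F i else 1.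
(** [false] is the lower triangular order and [true] the upper one, so that one argument serves both
    Gauss factors; [crossing] is the forbidden position of a simple reflection in that order. *)
Definition orient o : 'S_r.+1 := if o then flip else 1%g.
Definition crossing o i := if o then (hi i, lo i) else (lo i, hi i).

Definition to_step o (a : letter r * M) : step F r :=
  (a.2, bar a.1, if a.1 is Pos i then Some (crossing o i) else None).

(** For a crossing letter, met by x_i(t) in the lower order and by the inverse of x_{-i}(t) in the
    upper one: like [sbar], each has a single nonzero entry on the wrong side of the diagonal. *)
Definition bar_like o (a : letter r * M) : Prop :=
  a.2 \is a GRing.unit /\
  if a.1 is Pos i then
    a.2 (crossing o i).1 (crossing o i).2 != 0 /\
    forall b c, (orient o b < orient o c)%N -> (b, c) != crossing o i ->
      a.2 b c = 0
  else tri (orient o) a.2.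

Lemma bar_unit a : bar a \is a GRing.unit.
Proof.
by case: a => i /=; [have [] := sbar_inv F i | apply: unitr1].
Qed.

Lemma prod_unit (I : Type) (s : seq I) (f : I -> M) :
  List.Forall (fun a => f a \is a GRing.unit) s ->
  \prod_(a <- s) f a \is a GRing.unit.
Proof.
elim=> [|a s' ua _ us']; rewrite ?big_nil ?unitr1 // big_cons.
exact: unitr_mul.
Qed.

Lemma prod_bar_unit (s : seq (letter r)) : \prod_(a <- s) bar a \is a GRing.unit.
Proof.
apply: (big_ind (fun x : M => x \is a GRing.unit)); first exact: unitr1.
  exact: unitr_mul.
by move=> a _; apply: bar_unit.
Qed.

Lemma prod_bar (s : seq (letter r)) : reduced s ->
  \prod_(a <- s) bar a = sgnmx F (sprod s).
Proof.
move=> red_s; rewrite -prod_sbar //.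
elim: s {red_s} => [|[i|i] s IH]; first by rewrite !big_nil.
  by rewrite /= !big_cons IH.
by rewrite big_cons IH mul1r.
Qed.

Lemma orient_crossing o i :
  orient o (crossing o i).2 = (orient o (crossing o i).1).+1 :> nat.
Proof.
case: o; rewrite /crossing /orient /= ?perm1 ?hiE // !permE.
by rewrite /= /bump /=; have := ltn_ord i; lia.
Qed.

Lemma step_perm_word o (a : letter r * M) :
  step_perm (to_step o a).2 = sgen a.1.
Proof. by case: a => [[i|i] x] //=; case: o => //=; rewrite tpermC. Qed.

Lemma bar_mono o i : mono (tperm (crossing o i).1 (crossing o i).2) (bar (Pos i)).
Proof.
have -> : tperm (crossing o i).1 (crossing o i).2 = tperm (lo i) (hi i).
  by case: o; rewrite //= tpermC.
move=> b c; rewrite /bar mxE; have ne_lh := lo_neq_hi i.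
case: tpermP => [->|->|/eqP ne_cl /eqP ne_ch].
- by move=> /negbTE->; rewrite eqxx (negbTE ne_lh) /=; case: eqP.
- by move=> /negbTE->; rewrite eqxx eq_sym (negbTE ne_lh) /=; case: eqP.
- by rewrite (negbTE ne_cl) (negbTE ne_ch) !andbF => /negbTE->.
Qed.

Lemma step_ok_word o a : bar_like o a ->
  step_ok (orient o) (to_step o a).1.1 (to_step o a).1.2 (to_step o a).2.
Proof.
case: a => -[i|i] x [/= ux] => [[x_pq tx]|tx]; split=> //; try exact: (bar_unit (Pos i)).
  move: (orient_crossing o i) (@bar_mono o i) x_pq tx.
  by case: (crossing o i) => p q /= s_pq mg x_pq tx; split.
exact: unitr1.
Qed.

Lemma suffix_rank_word o l :
  suffix_rank (orient o) (map (to_step o) l) =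
  ((sprod (map fst l))^-1 * orient o)%g.
Proof.
elim: l => [|a l IH] /=; first by rewrite invg1 mul1g.
rewrite -/((to_step o a).2) step_perm_word IH invMg mulgA; congr (_ * _ * _)%g.
by apply/eqP; rewrite eq_sym eq_invg_mul sgen_sqr.
Qed.

Lemma orient_lt o i w : (w (lo i) < w (hi i))%N ->
  ((w * orient o)%g (crossing o i).1 < (w * orient o)%g (crossing o i).2)%N.
Proof. by case: o; rewrite /= ?mulg1 // flip_lt. Qed.

Lemma suffix_rising_word o l : reduced (map fst l) -> List.Forall (bar_like o) l ->
  suffix_rising (orient o) (map (to_step o) l).
Proof.
elim: l => [|a l IH] //= red_l /List.Forall_cons_iff[ok_a ok_l].
split; first exact: step_ok_word.
  rewrite suffix_rank_word; case: a red_l {ok_a} => -[i|//] x /= red_l.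
  have := orient_lt o (reduced_rising red_l).
  by case: (crossing o i).
by apply: IH => //; apply: (@reduced_catr _ [:: a.1]).
Qed.

(** [s] collects the letters already removed. Since [s] followed by the next letter is reduced, the
    pair of that letter rises under [sprod s], and [flip] turns rising into falling. *)
Lemma prefix_falling_word o (s : seq (letter r)) l : reduced (s ++ map fst l) ->
  prefix_falling (sprod s * (orient o * flip))%g (map (to_step o) l).
Proof.
elim: l s => [|a l IH] //= s red_l; split.
  case: a red_l => -[i|//] x /= red_l; move: red_l; rewrite -cat_rcons.
  move=> /reduced_catl/reduced_rising_rev /(orient_lt o).
  by case: (crossing o i) => p q /=; rewrite mulgA flip_lt.
rewrite -/((to_step o a).2) step_perm_word.
have := IH (rcons s a.1); rewrite cat_rcons => /(_ red_l).
by rewrite -cats1 sprod_cat /= mul1g -mulgA.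
Qed.

Lemma sandwich_word o l : sandwich (map (to_step o) l) =
  \prod_(a <- l) a.2 * \prod_(a <- rev (map fst l)) bar a.
Proof.
elim: l => [|a l IH] /=; first by rewrite !big_nil mulr1.
by rewrite IH rev_cons -cats1 big_cat big_seq1 big_cons !mulrA.
Qed.

(** Strips all of [l1] at once; with the lower letters this produces c_k. *)
Lemma peeled_cat o l1 l2 x : List.Forall (bar_like o) l1 ->
  peeled (orient o) x (map (to_step o) (l1 ++ l2)) ->
  peeled (orient o)
    ((\prod_(a <- l1) a.2)^-1 * x * (\prod_(a <- rev (map fst l1)) bar a)^-1)
    (map (to_step o) l2).
Proof.
elim: l1 x => [|a l1 IH] x /=; first by rewrite !big_nil invr1 mul1r mulr1.
case/List.Forall_cons_iff => -[ua _] ok_l1 [_ /(IH _ ok_l1)].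
rewrite rev_cons -cats1 big_cat big_seq1 big_cons.
rewrite !invrM ?bar_unit ?prod_bar_unit ?mulrA //.
by apply: prod_unit; apply: List.Forall_impl ok_l1 => b [].
Qed.

(** With the lower letters, [d] is [[x' (v^-1)bar]_-]; with the inverses in reverse order it is the
    inverse of [[ubar^-1 x']_+]. In that second use, the ranking by the inverse word places x' in U
    ubar U. *)
Lemma word_factorization o l : reduced (map fst l) -> List.Forall (bar_like o) l ->
  exists d x,
    [/\ \prod_(a <- l) a.2 * \prod_(a <- rev (map fst l)) bar a = d * x,
        d \is a GRing.unit & tri (orient o) d] /\
    [/\ x \is a GRing.unit, tri (orient o * flip)%g x,
        tri ((sprod (map fst l))^-1 * orient o)%g x, unidiag x &
        peeled (orient o) d (map (to_step o) l)].
Proof.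
move=> red_l ok_l.
have [d [x [dxE ud td [ux tx tx' dx peel_d]]]] :=
  sandwichP skewF (suffix_rising_word red_l ok_l).
rewrite sandwich_word in dxE; rewrite suffix_rank_word in tx'.
exists d, x; split; split=> //.
have := @prefix_falling_word o [::] l red_l; rewrite /= mul1g => fall_l.
rewrite -[d]mulr1; apply: peel_d fall_l _ _ _; try exact: tri1.
exact: unidiag1.
Qed.

End PeeledWords.

(** * The twist of a factorized element *)

Section Factorization.
Variables (F : unitRingType) (skewF : GRing.field_axiom F) (r : nat).
Local Notation M := (gmx F r).
Implicit Types (x y z c d n : M) (p q b e : 'I_r.+1) (i : 'I_r) (u v w : 'S_r.+1).
Implicit Types (k : F) (s : seq (letter r)) (l : seq (letter r * F)) (a : letter r * F).

Definition xg a : M := xgen a.1 a.2.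

Lemma phi_out i (ka kb kc kd : F) p q : p != q -> (p, q) != (lo i, hi i) ->
  (p, q) != (hi i, lo i) -> phi i ka kb kc kd p q = 0.
Proof.
rewrite mxE !xpair_eqE => ne_pq /negbTE-> /negbTE->.
case: andP => [[/eqP pE /eqP qE]|_]; first by rewrite pE qE eqxx in ne_pq.
case: andP => [[/eqP pE /eqP qE]|_]; first by rewrite pE qE eqxx in ne_pq.
by rewrite (negbTE ne_pq).
Qed.

Lemma phi_lohi i (ka kb kc kd : F) :
  (phi i ka kb kc kd (lo i) (hi i) = kb) * (phi i ka kb kc kd (hi i) (lo i) = kc).
Proof.
by rewrite !mxE !eqxx [hi i == lo i]eq_sym (negbTE (lo_neq_hi i)) /=.
Qed.

Lemma xg_inv a : a.2 != 0 -> xg a \is a GRing.unit /\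
  (xg a)^-1 = match a.1 with
              | Pos i => phi i 1 (- a.2) 0 1
              | Neg i => phi i a.2 0 (-1) a.2^-1
              end :> M.
Proof.
case: a => -[i|i] k /= nz_k; apply: unitr_invE; rewrite /xg /= phiM.
all: rewrite ?(mulVr (skewF nz_k)) ?(mulrV (skewF nz_k)).
all: rewrite !(mulr0, mul0r, mul1r, mulr1, mulN1r, mulrN1, addr0, add0r).
all: by rewrite ?subrr ?addNr ?phi1.
Qed.

Definition lower_letter a : letter r * M := (a.1, xg a).
(** For the upper order it is the inverses of the negative letters that cross, hence the change of
    sign of the letter. *)
Definition upper_letter a : letter r * M := (oppl a.1, (xg a)^-1).

Lemma bar_like_lower a : a.2 != 0 -> bar_like false (lower_letter a).
Proof.
move=> nz_a; split; first by have [] := xg_inv nz_a.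
case: a nz_a => -[i|i] k /= nz_k; first split.
- by rewrite /xg /= phi_lohi.
- move=> b e; rewrite !perm1 => lt_be ne_be; apply: phi_out => //.
    by apply: contraTneq lt_be => ->; rewrite ltnn.
  by apply: contraTneq lt_be => -[-> ->]; rewrite hiE; lia.
- move=> b e; rewrite !perm1 => lt_be.
  have [[-> ->]|ne_be] := eqVneq (b, e) (lo i, hi i); first by rewrite /xg /= phi_lohi.
  apply: phi_out => //; first by apply: contraTneq lt_be => ->; rewrite ltnn.
  by apply: contraTneq lt_be => -[-> ->]; rewrite hiE; lia.
Qed.

Lemma bar_like_upper a : a.2 != 0 -> bar_like true (upper_letter a).
Proof.
move=> nz_a; have [ua aV] := xg_inv nz_a; split; first by rewrite unitrV.
rewrite /upper_letter /= aV; case: a nz_a {ua aV} => -[i|i] k /= nz_k; last split.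
- move=> b e; rewrite flip1_lt => lt_eb.
  have [[-> ->]|ne_be] := eqVneq (b, e) (hi i, lo i); first by rewrite phi_lohi.
  apply: phi_out => //; first by apply: contraTneq lt_eb => ->; rewrite ltnn.
  by apply: contraTneq lt_eb => -[-> ->]; rewrite hiE; lia.
- by rewrite phi_lohi oppr_eq0 oner_eq0.
- move=> b e; rewrite flip1_lt => lt_eb ne_be; apply: phi_out => //.
    by apply: contraTneq lt_eb => ->; rewrite ltnn.
  by apply: contraTneq lt_eb => -[-> ->]; rewrite hiE; lia.
Qed.

Lemma diag_neg i k c : k != 0 -> tri 1%g c ->
  ((xg (Neg i, k))^-1 * c) (lo i) (lo i) = k * c (lo i) (lo i) /\
  ((xg (Neg i, k))^-1 * c) (hi i) (hi i) = k^-1 * c (hi i) (hi i).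
Proof.
move=> nz_k tc; have [_ ->] := @xg_inv (Neg i, k) nz_k.
rewrite !phi_mull !eqxx [hi i == lo i]eq_sym (negbTE (lo_neq_hi i)) mul0r addr0.
by rewrite (tc (lo i) (hi i)) ?mulr0 ?add0r // !perm1 lo_lt_hi.
Qed.

(** The vanishing of [c] at [(lo i, hi i)] forces [d (lo i) (lo i) = - k * d (hi i) (lo i)], which
    eliminates the subdiagonal entry from [c (hi i) (hi i) = - d (hi i) (lo i)]. *)
Lemma diag_pos i k c d : k != 0 -> tri 1%g c -> tri 1%g d ->
    c = xg (Pos i, k) * d * bar F (Pos i) ->
  c (lo i) (lo i) = k * d (hi i) (hi i) /\
  c (hi i) (hi i) = k^-1 * d (lo i) (lo i).
Proof.
move=> nz_k tc td cE; have ne_hl : (hi i == lo i) = false.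
  by rewrite eq_sym (negbTE (lo_neq_hi i)).
have clh := tc (lo i) (hi i); rewrite !perm1 lo_lt_hi in clh.
have dlh : d (lo i) (hi i) = 0 by apply: td; rewrite !perm1 lo_lt_hi.
move: (clh isT); rewrite cE /xg /bar /= !phi_mulr !phi_mull !eqxx ne_hl.
rewrite !mulr0 !mul0r !mul1r !mulr1 !mulrN1 !addr0 !add0r dlh add0r.
move=> /eqP; rewrite oppr_eq0 addr_eq0 => /eqP ->.
by rewrite mulrN mulKr //; apply: skewF.
Qed.

(** A positive letter contributes a unitriangular factor. For a negative one, the vanishing of [c]
    at [(hi i, lo i)] forces [d (lo i) (hi i) = k^-1], which cancels the scaling of row [lo i] by
    [k]. *)
Lemma unidiag_upper a c d : a.2 != 0 -> tri flip c -> tri flip d -> unidiag d ->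
  c = (xg a)^-1 * d * bar F (oppl a.1) -> unidiag c.
Proof.
move=> nz_a tc td dd cE p; have [_ aV] := xg_inv nz_a.
case: a nz_a cE aV => -[i|i] k /= nz_k; set A := (xg _)^-1 => cE aV.
  rewrite cE mulr1 (@triM_diag _ _ flip) // ?dd ?aV ?mulr1.
    rewrite mxE eqxx !andbb; case: eqP => // _.
    by rewrite andbC; case: eqP => //=; case: eqP.
  by have [_] := @bar_like_upper (Pos i, k) nz_k; rewrite /= -/A aV.
have ne_hl : (hi i == lo i) = false by rewrite eq_sym (negbTE (lo_neq_hi i)).
have dhl : d (hi i) (lo i) = 0 by apply: td; rewrite flip1_lt lo_lt_hi.
have : c (hi i) (lo i) = 0 by apply: tc; rewrite flip1_lt lo_lt_hi.
rewrite {1}cE aV /bar /= !phi_mulr !phi_mull !eqxx ne_hl !dd dhl.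
rewrite !mulr0 !mulr1 !add0r mulN1r => /eqP.
rewrite addrC subr_eq0 => /eqP dlh; rewrite cE aV phi_mulr !phi_mull.
have [pl|pl] := eqVneq p (lo i); last have [ph|ph] := eqVneq p (hi i).
- by rewrite -dlh mulr0 add0r mul0r addr0 mulr1 mulrV //; apply: skewF.
- by rewrite dd dhl !mulr0 mulr1 !addr0 mulrN1 opprK.
- by rewrite dd.
Qed.

Definition nonzero l : Prop := List.Forall (fun a => a.2 != 0) l.
Definition xprod l : M := \prod_(a <- l) xg a.
Definition word l : seq (letter r) := map fst l.
Definition opp_word l : seq (letter r) := map (@oppl r) (word l).

Lemma opp_word_rev l : opp_word (rev l) = rev (opp_word l).
Proof. by rewrite /opp_word /word !map_rev. Qed.

Lemma nonzero_rev l : nonzero l -> nonzero (rev l).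
Proof.
elim=> [|a l' nz_a _ IH]; first exact: List.Forall_nil.
by rewrite rev_cons -cats1; apply/List.Forall_app; split=> //; constructor.
Qed.

Lemma xprod_unit l : nonzero l -> xprod l \is a GRing.unit.
Proof.
move=> nz_l; apply: prod_unit; apply: List.Forall_impl nz_l => a nz_a.
by have [] := xg_inv nz_a.
Qed.

Lemma word_lower l : map fst (map lower_letter l) = word l.
Proof. by rewrite -map_comp. Qed.

Lemma word_upper l : map fst (map upper_letter l) = opp_word l.
Proof. by rewrite /opp_word /word -!map_comp. Qed.

Lemma prod_lower l : \prod_(b <- map lower_letter l) b.2 = xprod l.
Proof. by rewrite big_map. Qed.

Lemma prod_upper l : nonzero l ->
  \prod_(b <- map upper_letter (rev l)) b.2 = (xprod l)^-1.
Proof.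
rewrite big_map /xprod; elim=> [|a l' nz_a nz_l IH]; first by rewrite !big_nil invr1.
rewrite rev_cons -cats1 big_cat big_seq1 big_cons /= IH invrM //.
  by have [] := xg_inv nz_a.
exact: xprod_unit.
Qed.

Lemma Forall_lower l : nonzero l -> List.Forall (bar_like false) (map lower_letter l).
Proof.
by elim=> [|a l' nz_a _ IH] /=; constructor; rewrite //; apply: bar_like_lower.
Qed.

Lemma Forall_upper l : nonzero l -> List.Forall (bar_like true) (map upper_letter l).
Proof.
by elim=> [|a l' nz_a _ IH] /=; constructor; rewrite //; apply: bar_like_upper.
Qed.

Lemma peeled_tri (o : bool) c (l : seq (letter r * M)) :
  peeled (orient r o) c (map (to_step o) l) -> tri (orient r o) c.
Proof. by case: l => [|a l] []. Qed.

(** Unit diagonals propagate from the fully stripped remnant back to [c], one layer at a time. *)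
Lemma unidiag_peeled l c : nonzero l ->
  peeled (orient r true) c (map (to_step true) (map upper_letter l)) -> unidiag c.
Proof.
move=> nz_l; elim: nz_l c => [|a l' nz_a _ IH] c /= [tc] //.
set d := (_ * _ * _) => peel_d; have [ua aV] := xg_inv nz_a.
apply: (unidiag_upper nz_a tc (peeled_tri peel_d) (IH _ peel_d)).
by rewrite /d -mulrA mulrVK ?bar_unit // invrK mulKr.
Qed.

(** Conjugation by [Jg] negates the entries next to the diagonal, so the positive inverse is an
    anti-automorphism fixing every [sbar]. *)
Lemma Jg_bar s : Jg F r * (\prod_(a <- s) bar F a)^-1 * Jg F r =
  \prod_(a <- rev s) bar F a.
Proof.
elim: s => [|a s IH]; first by rewrite !big_nil invr1 mulr1 Jg_sqr.
rewrite rev_cons -cats1 big_cat big_seq1 big_cons invrM ?bar_unit ?prod_bar_unit //.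
rewrite Jg_conjM IH; congr (_ * _); case: a => i /=; last first.
  by rewrite invr1 mulr1 Jg_sqr.
have [_ ->] := sbar_inv F i.
apply/matrixP => p q; rewrite Jg_conj //.
have [<-|ne_pq] := eqVneq p q.
  rewrite exprD -expr2 sqrr_sign mul1r !mxE eqxx.
  by rewrite !andbb; case: (p == lo i) => //=; rewrite !andbF.
have sgn_hl : (-1) ^+ (hi i + lo i) = -1 :> F.
  by rewrite hiE addSn exprS exprD -expr2 sqrr_sign mulr1.
have [[-> ->]|ne_lh] := eqVneq (p, q) (lo i, hi i).
  by rewrite addnC sgn_hl !phi_lohi mulr1.
have [[-> ->]|ne_hl] := eqVneq (p, q) (hi i, lo i).
  by rewrite sgn_hl !phi_lohi mulrNN mulr1.
by rewrite !phi_out ?mulr0.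
Qed.

(** One [c0] serves all the splittings of [l], which makes the matrices [c] at consecutive positions
    comparable. *)
Lemma twist_factorization l (h : 'I_r.+1 -> F) u v
    (D := diag_mx (\row_p h p) : M) (x := D * xprod l) :
    nonzero l -> reduced (word l) -> reduced (opp_word l) ->
    sprod (word l) = v -> sprod (opp_word l) = u ->
    Hdiag (D : 'M[F]_r.+1) -> Gcell u v (x : 'M[F]_r.+1) ->
  exists c0 : M,
    (forall p, Delta_def p u 1%g x /\ Delta p u 1%g x = h (u p)) /\
    forall l1 l2, l = l1 ++ l2 ->
      let c := (xprod l1)^-1 * c0 * (\prod_(a <- rev (word l1)) bar F a)^-1 in
      [/\ c \is a GRing.unit, tri 1%g c &
      forall p, let vk := sprod (word l1) in let uk := sprod (rev (opp_word l2)) in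
        Delta_def p vk uk (twist u v x) /\
        Delta p vk uk (twist u v x) = h (vk p) * (c p p)^-1].
Proof.
move=> nz_l red_l red_l' lv lu HD Gx.
have uP := xprod_unit nz_l.
have [uD dD] : D \is a GRing.unit /\ is_diag_mx (D : 'M[F]_r.+1).
  by case: HD => /gmx_unitE.
have red_rev : reduced (rev (word l)) by apply: reduced_rev.
have red_rev' : reduced (opp_word (rev l)).
  by rewrite opp_word_rev; apply: reduced_rev.
have wv : wbar F v^-1%g = sgnmx F v^-1%g by rewrite -lv -sprod_rev wbarE.
have wu : wbar F u = sgnmx F u by rewrite -lu wbarE.
have uu : sgnmx F u \is a GRing.unit by rewrite -lu sgnmx_unit.
have := @word_factorization _ skewF r false (map lower_letter l).
rewrite word_lower => /(_ red_l (Forall_lower nz_l)).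
rewrite prod_lower prod_bar // sprod_rev lv.
case=> bm [xp [[Pv ubm tbm] [uxp txp _ dxp peel_bm]]].
rewrite /= mul1g in tbm txp.
(* Applied to the inverse of the product, so the upper factor [d'] stands on the left and [d'^-1] is
   the unipotent Gauss part of ubar^-1 x'. *)
have := @word_factorization _ skewF r true (map upper_letter (rev l)).
rewrite word_upper => /(_ red_rev' (Forall_upper (nonzero_rev nz_l))).
rewrite prod_upper // opp_word_rev revK prod_bar // sprod_rev lu invgK.
case=> d' [xm [[Pu ud' td'] [uxm txm txm' dxm peel_d']]].
rewrite /= in td'; have {}txm : tri 1%g xm.
  by move=> p q lt_pq; apply: txm; rewrite flip_lt flip1_lt !perm1 in lt_pq *.
have dd' := unidiag_peeled (nonzero_rev nz_l) peel_d'.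
have [txmV _ dxmV] := tri_inv skewF uxm txm.
have [txmV' _ _] := tri_inv skewF uxm txm'.
have [td'V _ dd'V] := tri_inv skewF ud' td'.
have PE : xprod l = sgnmx F u * (xm^-1 * d'^-1).
  rewrite -invrM // -Pu invrM ?unitrV // invrK.
  by rewrite mulVKr.
have unid' : unidiag d'^-1 by move=> p; rewrite dd'V dd' invr1.
have gm : gauss_minus ((xprod l : 'M[F]_r.+1) * wbar F v^-1%g) = bm.
  by rewrite /gauss_minus wv -[_ * _]/(xprod l * sgnmx F v^-1%g) Pv gaussE.
have gp : gauss_plus (mxinv (wbar F u) * (xprod l : 'M[F]_r.+1)) = d'^-1.
  rewrite /gauss_plus wu mxinvE //.
  rewrite -[_ * _]/((sgnmx F u)^-1 * xprod l) {1}PE mulKr // gaussE //.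
  - by rewrite unitrV.
  - by rewrite unitrV.
(* The second ranking of [xm] makes the conjugate of [xm^-1] by ubar upper unitriangular, which
   gives the left factor in U. Membership in B^- v B^- is inherited from [x], with [D^-1] absorbed
   into B^-. *)
have LP : Lcell u v (xprod l : 'M[F]_r.+1).
  split.
    exists (sgnmx F u * xm^-1 * (sgnmx F u)^-1).
      have mgV := mono_inv skewF uu (@mono_sgnmx F r u).
      have ugV : (sgnmx F u)^-1 \is a GRing.unit by rewrite unitrV.
      rewrite -[X in X * _ * _]invrK; apply/UupP; split.
      - by do ?apply: unitr_mul; rewrite ?unitrV.
      - by have := tri_conj skewF ugV mgV txmV'; rewrite mulgA mulVg mul1g.
      - by apply: (unidiag_conj skewF ugV mgV) => p; rewrite dxmV dxm invr1.
    exists d'^-1; first by apply/UupP; split; rewrite ?unitrV.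
    have eqP : sgnmx F u * xm^-1 * (sgnmx F u)^-1 * sgnmx F u * d'^-1 = xprod l.
      by rewrite mulrVK // PE mulrA.
    by rewrite wu; exact: eqP.
  case: Gx => _ [e1 /BlowP[ue1 te1] [e2 Be2 xE]].
  exists (D^-1 * e1).
    apply/BlowP; split; first by apply: unitr_mul; rewrite ?unitrV.
    apply: triM te1; have [] // := tri_inv skewF uD (is_diag_tri (s := 1%g) dD).
  exists e2 => //.
  have eqP : (D^-1 * e1) * (perm_matrix F v : M) * e2 = xprod l.
    apply: (mulrI uD); rewrite -!mulrA mulVKr // -[RHS]/x -xE mulrA.
    by [].
  exact: eqP.
have HE : Hfactor u v (x : 'M[F]_r.+1) = (D, xprod l).
  rewrite /Hfactor.
  have /(classical_sets.xgetPex (1, 1)) : exists p : M * M,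
      [/\ Hdiag p.1, Lcell u v p.2 & (x : 'M[F]_r.+1) = p.1 * p.2].
    by exists (D, xprod l).
  case: (classical_sets.xget _ _) => d2 x2 [/= Hd2 Lx2 xE].
  by have [-> ->] := Hfactor_uniq skewF wu uu Hd2 HD Lx2 LP (esym xE).
(* Since [Jg] squares to 1, the three positive inverses merge into one conjugation. *)
have yE : twist u v (x : 'M[F]_r.+1) =
    D * (Jg F r * (bm^-1 * xprod l * d') * Jg F r).
  rewrite /twist HE /= /twistL gm gp !piotaE ?unitrV //.
  rewrite mxinvE; last by apply: Jg_conj_unit; rewrite unitrV.
  have JPJ : (Jg F r * (xprod l)^-1 * Jg F r)^-1 = Jg F r * xprod l * Jg F r.
    rewrite !invrM ?unitrV ?Jg_unit ?unitr_mul ?unitrV ?Jg_unit //.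
    by rewrite invrK Jg_inv mulrA.
  by rewrite JPJ invrK !Jg_conjM.
have uDw w : sgnmx F w \is a GRing.unit ->
    (diag_mx (\row_p h (w p)) : M) \is a GRing.unit.
  move=> uw; have -> : (diag_mx (\row_p h (w p)) : M) = (sgnmx F w)^-1 * (D * sgnmx F w).
    by rewrite diag_mx_sgnmx mulKr.
  by do ?apply: unitr_mul; rewrite ?unitrV.
exists bm; split=> [p|l1 l2 lE c].
  (* Moving [D] across ubar permutes its entries, and [xm^-1] has unit diagonal, so only an entry of
     [h] remains. *)
  have := @Delta_LU F skewF r x (diag_mx (\row_p h (u p)) * xm^-1) d'^-1 u 1%g p.
  rewrite sgnmx1 mulr1 {1}/x PE !mulrA diag_mx_sgnmx => /(_ erefl).
  case=> //; first by apply: unitr_mul; rewrite ?unitrV // uDw.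
  - by rewrite unitrV.
  - by apply: triM txmV; apply: tri_diag_mx.
  move=> defD ->; split=> //; rewrite (triM_diag _ (@tri_diag_mx F r 1%g _) txmV).
  by rewrite diag_mx_diag dxmV dxm invr1 mulr1.
have [nz1 nz2] : nonzero l1 /\ nonzero l2.
  by move: nz_l; rewrite lE => /List.Forall_app.
have uP1 := xprod_unit nz1; have uP2 := xprod_unit nz2.
pose g := \prod_(a <- rev (word l1)) bar F a.
have ug : g \is a GRing.unit by apply: prod_bar_unit.
have uc : c \is a GRing.unit.
  by do ?apply: unitr_mul; rewrite ?unitrV.
have tc : tri 1%g c.
  have := @peeled_cat F r false (map lower_letter l1) (map lower_letter l2) bm.
  rewrite -map_cat -lE prod_lower word_lower.
  by move=> /(_ (Forall_lower nz1) peel_bm)/peeled_tri.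
pose f := \prod_(a <- opp_word l2) bar F a.
have uf : f \is a GRing.unit by apply: prod_bar_unit.
(* The inverse of S_k, obtained by stripping letters from the other end of the word. *)
pose T := xprod l2 * d' * f^-1.
have uT : T \is a GRing.unit by do ?apply: unitr_mul; rewrite ?unitrV.
have := @peeled_cat F r true (map upper_letter (rev l2)) (map upper_letter (rev l1)) d'.
rewrite -map_cat -rev_cat -lE prod_upper // word_upper opp_word_rev revK invrK.
move=> /(_ (Forall_upper (nonzero_rev nz2)) peel_d') peel_T.
have tT : tri flip T by apply: peeled_tri peel_T.
have dT : unidiag T by apply: unidiag_peeled (nonzero_rev nz1) peel_T.
have red1 : reduced (word l1).
  by move: red_l; rewrite lE /word map_cat => /reduced_catl.
have red2 : reduced (rev (opp_word l2)).
  apply: reduced_rev.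
  by move: red_l'; rewrite lE /opp_word /word !map_cat => /reduced_catr.
have bmE : bm = xprod l1 * c * g by rewrite /c -/g !mulrA divrr // mul1r mulrVK.
have TE : T * f = xprod l2 * d' by rewrite mulrVK.
have PE' : xprod l = xprod l1 * xprod l2 by rewrite lE /xprod big_cat.
clearbody c T.
(* Conjugation by [Jg] will turn [g^-1] and [f^-1] into the lifts of [vk] and [uk], the shape that
   [Delta_LU] expects. *)
have midE : bm^-1 * xprod l * d' = g^-1 * c^-1 * (T * f).
  rewrite TE PE' bmE invrM ?unitr_mul // invrM //.
  by rewrite -!mulrA mulKr.
have gE : Jg F r * g^-1 * Jg F r = sgnmx F (sprod (word l1)).
  by rewrite Jg_bar revK prod_bar.
have fE : Jg F r * f^-1 * Jg F r = sgnmx F (sprod (rev (opp_word l2))).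
  by rewrite Jg_bar prod_bar.
have [tcV _ dcV] := tri_inv skewF uc tc.
split=> // p vk uk.
have := @Delta_LU F skewF r (twist u v (x : 'M[F]_r.+1))
  (diag_mx (\row_p h (vk p)) * (Jg F r * c^-1 * Jg F r)) (Jg F r * T * Jg F r) vk uk p.
case.
- rewrite yE midE !Jg_conjM gE -/vk.
  set A := Jg F r * c^-1 * Jg F r; set B := Jg F r * T * Jg F r.
  have ffV : Jg F r * f * Jg F r * sgnmx F uk = 1.
    by rewrite -fE -Jg_conjM divrr // mulr1 Jg_sqr.
  rewrite -[LHS]mulrA -[_ * sgnmx F uk]mulrA -[_ * sgnmx F uk]mulrA ffV mulr1.
  by rewrite -!mulrA [RHS]mulrA -diag_mx_sgnmx !mulrA.
- by apply: unitr_mul; [apply/uDw/sgnmx_unit | apply/Jg_conj_unit; rewrite unitrV].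
- exact: Jg_conj_unit.
- by apply: triM (tri_Jg_conj _ tcV); rewrite //; apply: tri_diag_mx.
- exact: tri_Jg_conj.
- by move=> q; rewrite Jg_conj_diag.
move=> defD ->; split=> //.
rewrite (triM_diag _ (@tri_diag_mx F r 1%g _) (tri_Jg_conj skewF tcV)).
by rewrite diag_mx_diag Jg_conj_diag // dcV.
Qed.

End Factorization.

(** * Recovering the parameters from consecutive quasiminors *)

Section TwistSteps.
Variables (F : unitRingType) (skewF : GRing.field_axiom F) (r : nat).
Local Notation M := (gmx F r).
Implicit Types (l : seq (letter r * F)) (a : letter r * F).

(** Both quasiminors carry [h0] on the left, so it cancels in the quotient and [c * k^-1] is left,
    in this order. *)
Lemma ratio_eq (h0 c k t : F) : h0 != 0 -> c != 0 -> k != 0 -> c = t * k ->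
  h0 * c^-1 != 0 /\ t = (h0 * c^-1)^-1 * (h0 * k^-1).
Proof.
move=> nz_h nz_c /skewF uk ctk; split.
  by apply: mulf_neq0_skew; rewrite // invr_eq0.
have [uh uc] := (skewF nz_h, skewF nz_c).
by rewrite invrM ?unitrV // invrK mulrA mulrVK // ctk mulrK.
Qed.

(** The matrices [c] and [c1] before and after the letter differ by one layer, so [diag_pos] and
    [diag_neg] relate their diagonals through [t]. *)
Lemma twist_step l (h : 'I_r.+1 -> F) u v
    (D := diag_mx (\row_p h p) : M) (x := D * xprod l) (y := twist u v x) l1 a l2 :
    nonzero l -> reduced (word l) -> reduced (opp_word l) ->
    sprod (word l) = v -> sprod (opp_word l) = u ->
    Hdiag (D : 'M[F]_r.+1) -> Gcell u v (x : 'M[F]_r.+1) ->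
    l = rcons l1 a ++ l2 ->
  let v0 := sprod (word l1) in let v1 := sprod (word (rcons l1 a)) in
  let u0 := sprod (rev (opp_word l2)) in
  let u1 := sprod (rev (opp_word (a :: l2))) in
  let t := a.2 in
  match a.1 with
  | Neg i =>
    [/\ Delta_def (lo i) v0 u0 y, Delta_def (lo i) v0 u1 y,
        Delta (lo i) v0 u0 y != 0 &
        t = (Delta (lo i) v0 u0 y)^-1 * Delta (lo i) v0 u1 y] /\
    [/\ Delta_def (hi i) v0 u1 y, Delta_def (hi i) v0 u0 y,
        Delta (hi i) v0 u1 y != 0 &
        t = (Delta (hi i) v0 u1 y)^-1 * Delta (hi i) v0 u0 y]
  | Pos i =>
    [/\ Delta_def (lo i) v1 u0 y, Delta_def (hi i) v0 u0 y,
        Delta (lo i) v1 u0 y != 0 &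
        t = (Delta (lo i) v1 u0 y)^-1 * Delta (hi i) v0 u0 y] /\
    [/\ Delta_def (lo i) v0 u0 y, Delta_def (hi i) v1 u0 y,
        Delta (lo i) v0 u0 y != 0 &
        t = (Delta (lo i) v0 u0 y)^-1 * Delta (hi i) v1 u0 y]
  end.
Proof.
move=> nz_l red_l red_l' lv lu HD Gx lE v0 v1 u0 u1 t.
have [c0 [_ Hc]] := twist_factorization skewF nz_l red_l red_l' lv lu HD Gx.
have nz_h p : h p != 0.
  case: HD => /gmx_unitE uD dD.
  have [_ nz_D _] := tri_inv skewF uD (is_diag_tri (s := 1%g) dD).
  by have := nz_D p; rewrite diag_mx_diag.
have [uc0 tc0] := Hc l1 (a :: l2) (etrans lE (cat_rcons _ _ _)).
have [uc1 tc1] := Hc (rcons l1 a) l2 lE.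
set c1 := (_ * _) in uc1 tc1 *; set c := (_ * _) in uc0 tc0 *.
have nz_a : a.2 != 0.
  by move: nz_l; rewrite lE cat_rcons => /List.Forall_app[_ /List.Forall_cons_iff[]].
have nz1 : nonzero l1 by move: nz_l; rewrite lE cat_rcons => /List.Forall_app[].
have [ua _] := xg_inv skewF nz_a.
have c1E : c1 = (xg a)^-1 * c * (bar F a.1)^-1.
  rewrite /c1 /c /word map_rcons rev_rcons big_cons /xprod -cats1 big_cat big_seq1.
  rewrite invrM ?(xprod_unit skewF nz1) // invrM ?bar_unit ?prod_bar_unit //.
  by rewrite !mulrA.
have v1E : v1 = (sgen a.1 * v0)%g.
  by rewrite /v1 /word -cats1 map_cat sprod_cat /= mul1g.
have u1E : u1 = (sgen (oppl a.1) * u0)%g.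
  by rewrite /u1 /opp_word /word /= rev_cons -cats1 sprod_cat /= mul1g.
have [_ nz_c _] := tri_inv skewF uc0 tc0.
have [_ nz_c1 _] := tri_inv skewF uc1 tc1.
clearbody c c1; rewrite -/v0 -/v1 -/u0 -/u1 -/x -/y.
move=> H1 H0; rewrite /t; move: nz_a ua c1E v1E u1E.
case: (a) => -[i|i] k /= nz_k ua c1E v1E u1E.
- have cE : c = xg (Pos i, k) * c1 * bar F (Pos i).
    by rewrite c1E -[RHS]mulrA (mulrVK (bar_unit F (Pos i))) mulVKr.
  have [clo chi] := diag_pos skewF nz_k tc0 tc1 cE.
  rewrite mul1g in u1E.
  (* Passing the letter swaps the images of [lo i] and [hi i], so the two quasiminors of each
     formula carry the same entry of [h]. *)
  have v1lo : v1 (lo i) = v0 (hi i) by rewrite v1E permM tpermL.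
  have v1hi : v1 (hi i) = v0 (lo i) by rewrite v1E permM tpermR.
  have [d1l D1l] := H1 (lo i); have [d1h D1h] := H1 (hi i).
  have [d0l D0l] := H0 (lo i); have [d0h D0h] := H0 (hi i).
  rewrite u1E in d0l D0l d0h D0h; rewrite v1lo in D1l; rewrite v1hi in D1h.
  have [] := @ratio_eq (h (v0 (hi i))) _ _ k (nz_h _) (nz_c1 (lo i)) (nz_c (hi i)).
    by rewrite chi mulVKr //; apply: skewF.
  have [] := @ratio_eq (h (v0 (lo i))) _ _ k (nz_h _) (nz_c (lo i)) (nz_c1 (hi i)) clo.
  by rewrite D1l D1h D0l D0h.
- rewrite mul1g in v1E; rewrite v1E in H1.
  have [clo chi] := diag_neg skewF i nz_k tc0.
  rewrite invr1 mulr1 in c1E; rewrite -c1E in clo chi.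
  have [d1l D1l] := H1 (lo i); have [d1h D1h] := H1 (hi i).
  have [d0l D0l] := H0 (lo i); have [d0h D0h] := H0 (hi i).
  have [] := @ratio_eq (h (v0 (lo i))) _ _ k (nz_h _) (nz_c1 (lo i)) (nz_c (lo i)) clo.
  have [] := @ratio_eq (h (v0 (hi i))) _ _ k (nz_h _) (nz_c (hi i)) (nz_c1 (hi i)).
    by rewrite chi mulVKr //; apply: skewF.
  by rewrite D1l D1h D0l D0h.
Qed.

End TwistSteps.

Theorem theorem4p16 (F : unitRingType) (skewF : GRing.field_axiom F)
    (r : nat) (u v : 'S_r.+1)
    (m : nat) (w : m.-tuple (letter r)) (hw : double_reduced_word u v w)
    (t : 'I_m -> F) (ht : forall k, t k != 0)
    (h : 'I_r.+1 -> F) (hh : Hdiag (diag_mx (\row_i h i)))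
    (x : 'M[F]_r.+1) (hx : Gcell u v x)
    (hfact : x = diag_mx (\row_i h i) * \prod_(k < m) xgen (tnth w k) (t k)) :
  (forall i : 'I_r.+1,
     Delta_def ((u^-1)%g i) u 1%g x /\ h i = Delta ((u^-1)%g i) u 1%g x) /\
  (let y := twist u v x in
   forall k : 'I_m,
     match tnth w k with
     | Neg i =>
       [/\ Delta_def (lo i) (v_lt w k) (u_gt w k) y,
           Delta_def (lo i) (v_lt w k) (u_ge w k) y,
           Delta (lo i) (v_lt w k) (u_gt w k) y != 0 &
           t k = (Delta (lo i) (v_lt w k) (u_gt w k) y)^-1
                 * Delta (lo i) (v_lt w k) (u_ge w k) y] /\
       [/\ Delta_def (hi i) (v_lt w k) (u_ge w k) y,
           Delta_def (hi i) (v_lt w k) (u_gt w k) y,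
           Delta (hi i) (v_lt w k) (u_ge w k) y != 0 &
           t k = (Delta (hi i) (v_lt w k) (u_ge w k) y)^-1
                 * Delta (hi i) (v_lt w k) (u_gt w k) y]
     | Pos i =>
       [/\ Delta_def (lo i) (v_le w k) (u_gt w k) y,
           Delta_def (hi i) (v_lt w k) (u_gt w k) y,
           Delta (lo i) (v_le w k) (u_gt w k) y != 0 &
           t k = (Delta (lo i) (v_le w k) (u_gt w k) y)^-1
                 * Delta (hi i) (v_lt w k) (u_gt w k) y] /\
       [/\ Delta_def (lo i) (v_lt w k) (u_gt w k) y,
           Delta_def (hi i) (v_le w k) (u_gt w k) y,
           Delta (lo i) (v_lt w k) (u_gt w k) y != 0 &
           t k = (Delta (lo i) (v_lt w k) (u_gt w k) y)^-1
                 * Delta (hi i) (v_le w k) (u_gt w k) y]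
     end).
Proof.
pose l := [seq (tnth w k, t k) | k <- enum 'I_m].
have wl : word l = w by rewrite /word -map_comp map_tnth_enum.
have nz_l : nonzero l.
  rewrite /nonzero /l; elim: (enum _) => [|k s IH]; first exact: List.Forall_nil.
  by constructor; [apply: ht|].
case: hw => /[swap] /reduced_wordP[lv red_l].
rewrite neg_partE -wl => /reduced_wordP[lu red_l']; rewrite -wl in lv red_l.
have xE : x = (diag_mx (\row_i h i) : gmx F r) * xprod l.
  by rewrite hfact /xprod big_map [index_enum _]unlock -enumT.
move: hx; rewrite xE => Gx; split=> [i|y k].
  have [c0 [/(_ (u^-1%g i)) + _]] :=
    twist_factorization skewF nz_l red_l red_l' lv lu hh Gx.
  by rewrite permKV => -[? ->].
have sz_l : size l = m by rewrite size_map size_enum_ord.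
have lk d : nth d l k = (tnth w k, t k).
  by rewrite (nth_map k) ?size_enum_ord // nth_ord_enum.
(* Positions count from 0: [take k] and [drop k.+1] omit the current letter, as in v_{<k} and
   u_{>k}, while [take k.+1] and [drop k] contain it. *)
have takeS : take k.+1 l = rcons (take k l) (tnth w k, t k).
  by rewrite (take_nth (tnth w k, t k)) ?sz_l ?lk.
have lE : l = rcons (take k l) (tnth w k, t k) ++ drop k.+1 l.
  by rewrite -takeS cat_take_drop.
have dropS : drop k l = (tnth w k, t k) :: drop k.+1 l.
  by rewrite (drop_nth (tnth w k, t k)) ?sz_l ?lk.
have := twist_step skewF nz_l red_l red_l' lv lu hh Gx lE.
rewrite -takeS -dropS /opp_word /word !map_take !map_drop -/(word l) wl.
by rewrite /v_lt /v_le /u_gt /u_ge !map_rev !map_drop.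
Qed.
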